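(* Let $F(a,b)$ be the free group with free basis $\{a,b\}$. There exist a Gromov-hyperbolic graph $Y$ (equipped with its simplicial metric $d_Y$, in which every edge has length $1$) and a simplicial isometric action of $F(a,b)$ on $Y$, such that $Y$ contains the Cayley graph of $F(a,b)$ with respect to $\{a,b\}$ as an $F(a,b)$-equivariantly embedded subgraph (so that elements of $F(a,b)$ are regarded as vertices of $Y$, and paths in this Cayley graph are regarded as paths in $Y$), and such that the following hold: 1. The action of $F(a,b)$ on $Y$ is acylindrical. 2. The action of $F(a,b)$ on $Y$ is purely loxodromic, that is, every $1\ne g\in F(a,b)$ acts on $Y$ as a loxodromic isometry. 3. For every $1\ne g\in F(a,b)$ we have $\|g\|_Y\ge 1/7$. 4. For any $p\in Y$ the orbit $F(a,b)p\subseteq Y$ is a quasiconvex subset of $Y$. 5. There exists $C\ge 1$ such that for any $x,y\in F(a,b)$, if $\alpha_{x,y}$ is a geodesic from $x$ to $y$ in the Cayley graph of $F(a,b)$ with respect to the basis $\{a,b\}$, and if $\beta=[x,y]_Y$ is a geodesic from $x$ to $y$ in $Y$, then $\alpha_{x,y}$ and $\beta$ are $C$-Hausdorff close in $Y$. 6. For any $p\in Y$, the orbit map $F(a,b)\to Y$, $g\mapsto gp$, is not a quasi-isometric embedding, and, moreover, the action of $F(a,b)$ on $Y$ is not metrically proper.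
   Context: For a group $G$ acting isometrically on a metric space $X$ and $g\in G$, the asymptotic translation length is $\|g\|_X:=\lim_{n\to\infty} d_X(x,g^nx)/n$, where $x\in X$ is a basepoint (the limit exists and does not depend on $x$). If $X$ is Gromov-hyperbolic, $g$ acts loxodromically on $X$ if and only if $\|g\|_X>0$. An isometric action of a group $G$ on a Gromov-hyperbolic space $X$ is acylindrical if for every $R\ge 0$ there exist $L\ge 1$ and $M\ge 1$ such that whenever $x,y\in X$ satisfy $d_X(x,y)\ge L$, then $\#\{g\in G : d_X(x,gx)\le R,\ d_X(y,gy)\le R\}\le M$. An isometric action of $G$ on $X$ is metrically proper if for every metric ball $B\subseteq X$ the set $\{g\in G : B\cap gB\neq\varnothing\}$ is finite. In the orbit map, $F(a,b)$ carries the word metric with respect to $\{a,b\}$. Two subsets of $Y$ are $C$-Hausdorff close in $Y$ if each is contained in the closed $C$-neighborhood of the other with respect to $d_Y$. *)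

(* Defs.v *)
From HB Require Import structures.
From mathcomp Require Import all_boot all_order all_algebra.
From mathcomp Require Import ring.
From mathcomp Require Import all_classical all_reals all_analysis.

Set Implicit Arguments.
Unset Strict Implicit.
Unset Printing Implicit Defensive.

Import Order.TTheory GRing.Theory Num.Theory.
Import numFieldNormedType.Exports.

Local Open Scope classical_set_scope.
Local Open Scope ring_scope.

Section FreeGroup.
Variable T : choiceType.

(* The free group on T, as reduced words in the generators and their inverses:
   [(t, true)] stands for the generator t and [(t, false)] for its inverse. *)
Local Notation letter := (T * bool)%type.

Definition linv (x : letter) : letter := (x.1, ~~ x.2).

Definition reduced (s : seq letter) : bool :=
  sorted (fun x y => y != linv x) s.

Record freeGroup : Type := FreeGroup { fword : seq letter; _ : reduced fword }.
HB.instance Definition _ := [isSub for fword].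
HB.instance Definition _ := [Choice of freeGroup by <:].

Lemma linvK : involutive linv.
Proof. by move=> [t e]; rewrite /linv /= negbK. Qed.

Definition lpush (x : letter) (s : seq letter) : seq letter :=
  if s is y :: s' then if y == linv x then s' else x :: s else [:: x].

Definition fmulw (s t : seq letter) : seq letter := foldr lpush t s.

Definition finvw (s : seq letter) : seq letter := rev (map linv s).

Lemma reduced_lpush x s : reduced s -> reduced (lpush x s).
Proof.
case: s => [//|y s] rs /=; case: eqP => [_|/eqP yx].
  by apply: path_sorted rs.
by rewrite /reduced /= yx.
Qed.

Lemma lpushK x s : reduced s -> lpush (linv x) (lpush x s) = s.
Proof.
case: s => [_|y s rs] /=; first by rewrite linvK eqxx.
case: eqP => [yE|/eqP yx] /=; last by rewrite linvK eqxx.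
case: s rs => [_|z s] /=; first by rewrite yE.
by rewrite /reduced /= yE !linvK => /andP[/negbTE ->].
Qed.

Lemma reduced_fmulw s t : reduced t -> reduced (fmulw s t).
Proof. by move=> rt; elim: s => //= x s; apply: reduced_lpush. Qed.

Lemma fmulw_lpush x s t : reduced t ->
  fmulw (lpush x s) t = lpush x (fmulw s t).
Proof.
move=> rt; case: s => [//|y s] /=; case: eqP => [->|//].
by rewrite -{1}(linvK x) lpushK // reduced_fmulw.
Qed.

Lemma fmulwA s t u : reduced u ->
  fmulw s (fmulw t u) = fmulw (fmulw s t) u.
Proof.
by move=> ru; elim: s => //= x s ->; rewrite -fmulw_lpush.
Qed.

Lemma lpush_cons x s : reduced (x :: s) -> lpush x s = x :: s.
Proof. by case: s => //= y s /andP[/negbTE ->]. Qed.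

Lemma fmulw_nil s : reduced s -> fmulw s [::] = s.
Proof.
elim: s => //= x s IH rs; rewrite IH; last exact: path_sorted rs.
exact: lpush_cons.
Qed.

Lemma finvwK : involutive finvw.
Proof.
move=> s; rewrite /finvw map_rev revK -map_comp -[RHS]map_id.
by apply: eq_map => x /=; rewrite linvK.
Qed.

Lemma reduced_finvw s : reduced s -> reduced (finvw s).
Proof.
rewrite /reduced /finvw rev_sorted sorted_map; apply: sub_sorted => x y /=.
by rewrite linvK; apply: contra => /eqP ->.
Qed.

Lemma fmulVw s : fmulw (finvw s) s = [::].
Proof.
elim: s => //= x s IH; rewrite /finvw /= rev_cons /fmulw foldr_rcons /=.
by rewrite linvK eqxx.
Qed.

Definition fone : freeGroup := @FreeGroup [::] isT.
Definition fmul (g h : freeGroup) : freeGroup :=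
  FreeGroup (reduced_fmulw (fword g) (valP h)).
Definition finv (g : freeGroup) : freeGroup :=
  FreeGroup (reduced_finvw (valP g)).

Lemma fmulA : associative fmul.
Proof. by move=> g h k; apply: val_inj; rewrite /= fmulwA // (valP k). Qed.
Lemma fmul1g : left_id fone fmul.
Proof. by move=> g; apply: val_inj. Qed.
Lemma fmulg1 : right_id fone fmul.
Proof. by move=> g; apply: val_inj; apply: fmulw_nil (valP g). Qed.
Lemma fmulVg : left_inverse fone finv fmul.
Proof. by move=> g; apply: val_inj; apply: fmulVw. Qed.
Lemma fmulgV : right_inverse fone finv fmul.
Proof.
by move=> g; apply: val_inj; rewrite /= -{1}(finvwK (fword g)) fmulVw.
Qed.

HB.instance Definition _ :=
  isGroup.Build freeGroup fmulA fmul1g fmulg1 fmulVg fmulgV.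

Definition fgen (t : T) : freeGroup := @FreeGroup [:: (t, true)] isT.

End FreeGroup.

Definition F2 : Type := freeGroup bool.
HB.instance Definition _ := Group.on F2.
Definition F2a : F2 := fgen true.
Definition F2b : F2 := fgen false.
Definition F2_basis : set F2 := [set F2a; F2b].

(* Connected simple graphs. The edge relation is symmetric, so edges are
   unoriented; connectedness is what makes the simplicial metric finite. *)
Record graph : Type := Graph {
  vertex :> choiceType;
  adj : rel vertex;
  adj_sym : symmetric adj;
  adj_irrefl : irreflexive adj;
  adj_connected : forall u v, exists2 p, path adj u p & last u p = v }.

Record graph_embedding (A B : graph) : Type := GraphEmbedding {
  emb :> A -> B;
  emb_inj : injective emb;
  emb_adj : forall u v, adj u v -> adj (emb u) (emb v) }.

(* The axioms force every [gact g] to be an automorphism of Y. *)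
Record graph_action (G : groupType) (Y : graph) : Type := GraphAction {
  gact :> G -> graph_embedding Y Y;
  gact1 : forall v, gact 1%g v = v;
  gactM : forall g h v, gact (g * h)%g v = gact g (gact h v) }.

Section Realization.
Variable R : realType.

Section Points.
Variable Y : graph.

(* Barycentric coordinates of the point at distance t from u on the edge uv. *)
Definition edge_pt (u v : Y) (t : R) : Y -> R :=
  fun w => (1 - t) * (w == u)%:R + t * (w == v)%:R.

Definition is_point (p : Y -> R) : Prop :=
  exists u v t, [/\ u = v \/ adj u v, 0 <= t <= 1 & p = edge_pt u v t].

(* The geometric realization of Y: vertices and points interior to edges. *)
Record realization : Type :=
  Realization { coord : Y -> R; coordP : is_point coord }.
HB.instance Definition _ := gen_eqMixin realization.
HB.instance Definition _ := gen_choiceMixin realization.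

Lemma coord_inj : injective coord.
Proof.
by case=> [p hp] [q hq] /= pq; subst q; rewrite (Prop_irrelevance hp hq).
Qed.

(* [chain p q l]: there is a piecewise linear path of length l from p to q. *)
Inductive chain (p : realization) : realization -> R -> Prop :=
| chain_nil : chain p p 0
| chain_rcons u v s t q r l :
    adj u v -> 0 <= s <= 1 -> 0 <= t <= 1 ->
    coord q = edge_pt u v s -> coord r = edge_pt u v t ->
    chain p q l -> chain p r (l + `|s - t|).

(* The length metric giving every edge length 1. *)
Definition rdist (p q : realization) : R := inf [set l | chain p q l].

Lemma chain_cat p q r l m : chain p q l -> chain q r m -> chain p r (l + m).
Proof.
move=> pq; elim=> [|u v s t x y n uv hs ht xE yE _ IH]; first by rewrite addr0.
by rewrite addrA; exact: chain_rcons uv hs ht xE yE IH.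
Qed.

Lemma chain_sym p q l : chain p q l -> chain q p l.
Proof.
elim=> [|u v s t x y n uv hs ht xE yE _ IH]; first exact: chain_nil.
rewrite addrC; apply: chain_cat IH; rewrite -[`|_|]add0r distrC.
by apply: chain_rcons uv ht hs yE xE (chain_nil _).
Qed.

Lemma chain_coord p q l w : chain p q l -> `|coord p w - coord q w| <= l.
Proof.
elim=> [|u v s t x y n uv hs ht xE yE _ IH]; first by rewrite subrr normr0.
rewrite (le_trans (ler_distD (coord x w) _ _)) // lerD // xE yE /edge_pt.
have -> : (1 - s) * (w == u)%:R + s * (w == v)%:R
    - ((1 - t) * (w == u)%:R + t * (w == v)%:R)
  = (s - t) * ((w == v)%:R - (w == u)%:R) :> R.
  by ring.
rewrite normrM ler_piMr //.
by case: eqP; case: eqP; rewrite ?subrr ?subr0 ?sub0r ?normrN ?normr1 ?normr0.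
Qed.

Lemma chain_ge0 p q l : chain p q l -> 0 <= l.
Proof.
move=> /[dup] /chain_coord h _; have [u _] := coordP p.
exact: le_trans (normr_ge0 _) (h u).
Qed.

Lemma edge_pt0 u v : edge_pt u v 0 = edge_pt u u 0.
Proof. by apply: funext => w; rewrite /edge_pt !mul0r. Qed.

Lemma edge_pt1 u v : edge_pt u v 1 = edge_pt v v 0.
Proof. by apply: funext => w; rewrite /edge_pt subrr subr0 !mul0r add0r addr0. Qed.

Lemma edge_ptxx u t : edge_pt u u t = edge_pt u u 0.
Proof. by apply: funext => w; rewrite /edge_pt -!mulrDl subr0 subrK addr0. Qed.

Lemma is_point_vertex u : is_point (edge_pt u u 0).
Proof. by exists u, u, 0; split; [left | rewrite lexx ler01 |]. Qed.

Definition rvertex (u : Y) : realization := Realization (is_point_vertex u).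

Lemma chain_vertex p : exists u l, chain p (rvertex u) l.
Proof.
have [u [v [t [uv ht pE]]]] := coordP p; exists u.
case: uv => [uv|uv].
  exists 0; suff -> : rvertex u = p by exact: chain_nil.
  by apply: coord_inj; rewrite pE -uv /= [RHS]edge_ptxx.
exists (0 + `|t - 0|); apply: (chain_rcons uv ht _ pE) (chain_nil p).
  by rewrite lexx ler01.
by rewrite /= [RHS]edge_pt0.
Qed.

Lemma chain_path u s : path (@adj Y) u s ->
  exists l, chain (rvertex u) (rvertex (last u s)) l.
Proof.
elim: s u => [u _|v s IH u /= /andP[uv /IH[l hl]]]; first by exists 0; constructor.
exists (0 + `|0 - 1| + l); apply: chain_cat hl.
apply: (@chain_rcons _ u v 0 1 (rvertex u)) => //=; rewrite ?lexx ?ler01 //.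
- by rewrite edge_pt0.
- by rewrite edge_pt1.
- exact: chain_nil.
Qed.

Lemma chain_ex p q : exists l, chain p q l.
Proof.
have [u [l pu]] := chain_vertex p; have [v [m qv]] := chain_vertex q.
have [s us vE] := adj_connected u v.
have [n] := chain_path us; rewrite vE => uv.
by exists (l + n + m); apply: chain_cat (chain_cat pu uv) (chain_sym qv).
Qed.

Lemma has_inf_chain p q : has_inf [set l | chain p q l].
Proof.
split; first by have [l] := chain_ex p q; exists l.
by exists 0 => l /= /chain_ge0.
Qed.

Lemma rdist_le p q l : chain p q l -> rdist p q <= l.
Proof. by move=> h; apply: ge_inf => //; case: (has_inf_chain p q). Qed.

Lemma rdist_lb p q (m : R) : (forall l, chain p q l -> m <= l) -> m <= rdist p q.
Proof.
by move=> h; apply: lb_le_inf; [case: (has_inf_chain p q) | move=> l /h].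
Qed.

Lemma rdist_xx p : rdist p p = 0.
Proof.
apply/eqP; rewrite eq_le rdist_le ?rdist_lb //; last exact: chain_nil.
by move=> l /chain_ge0.
Qed.

Lemma rdist_eq0 p q : rdist p q = 0 -> p = q.
Proof.
move=> pq0; apply: coord_inj; apply: funext => w; apply/eqP.
rewrite -subr_eq0 -normr_le0 -pq0; apply: rdist_lb => l; exact: chain_coord.
Qed.

Lemma rdist_sym p q : rdist p q = rdist q p.
Proof.
by apply/eqP; rewrite eq_le; apply/andP; split; apply: rdist_lb => l /chain_sym;
   apply: rdist_le.
Qed.

Lemma rdist_triangle q p r : rdist p r <= rdist p q + rdist q r.
Proof.
rewrite -lerBlDl; apply: rdist_lb => m qr; rewrite lerBlDl -lerBlDr.
by apply: rdist_lb => l pq; rewrite lerBlDr; apply: rdist_le (chain_cat pq qr).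
Qed.

HB.instance Definition _ :=
  isMetric.Build R realization rdist_xx rdist_eq0 rdist_sym rdist_triangle.

End Points.

Section Functoriality.
Variables (A B : graph) (f : graph_embedding A B).

(* Extension by zero of barycentric coordinates: the affine map of geometric
   realizations that extends f. *)
Definition push_coord (p : A -> R) (w : B) : R :=
  if pselect (exists u, f u = w) is left h then p (sval (cid h)) else 0.

Lemma push_edge_pt u v t : push_coord (edge_pt u v t) = edge_pt (f u) (f v) t.
Proof.
apply: funext => w; rewrite /push_coord /edge_pt; case: pselect => [h|h].
  by case: cid => x /= <-; rewrite !(inj_eq (@emb_inj _ _ f)).
case: eqP => [wu|_]; first by case: h; exists u.
by case: eqP => [wv|_]; [case: h; exists v | rewrite !mulr0 addr0].
Qed.

Lemma push_is_point p : is_point p -> is_point (push_coord p).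
Proof.
move=> [u [v [t [uv ht ->]]]]; exists (f u), (f v), t; split=> //.
  by case: uv => [->|/(emb_adj f)]; [left | right].
exact: push_edge_pt.
Qed.

Definition rmap (p : realization A) : realization B :=
  Realization (push_is_point (coordP p)).

End Functoriality.
End Realization.

Section Cayley.
Variables (G : groupType) (S : set G).

(* Edges join x to x s, so that left translations are automorphisms. *)
Definition cayley_adj : rel G :=
  fun x y => `[< exists2 s, S s & (y = x * s)%g \/ (x = y * s)%g >].

Variable R : realType.

(* The least length of a word over S and its inverses that represents g; the
   infimum is over a set of natural numbers, nonempty when S generates G. *)
Definition word_norm (g : G) : R :=
  inf [set (size s)%:R | s in
    [set s : seq G | {in s, forall x, S x \/ S (x^-1)%g} /\
                     (\prod_(x <- s) x)%g = g]].

Definition word_dist (x y : G) : R := word_norm (x^-1 * y)%g.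

End Cayley.

Lemma cayley_adj_sym : symmetric (cayley_adj F2_basis).
Proof.
by move=> x y; apply/asboolP/asboolP => -[s Ss h]; exists s => //; case: h; auto.
Qed.

Lemma F2_basis_neq1 s : F2_basis s -> s != 1%g.
Proof. by case=> ->. Qed.

Lemma cayley_adj_irrefl : irreflexive (cayley_adj F2_basis).
Proof.
move=> x; apply/asboolP => -[s /F2_basis_neq1/eqP s1].
by case=> /esym/eqP; rewrite -{2}[x]mulg1 (inj_eq (mulgI x)) => /eqP.
Qed.

Lemma cayley_connected (g h : F2) :
  exists2 p, path (cayley_adj F2_basis) g p & last g p = h.
Proof.
rewrite -(mulVKg g h); case: (g^-1 * h)%g => s; elim: s g => [|x s IH] g rs.
  exists [::] => //=; rewrite -[LHS]mulg1; congr (_ * _)%g; exact: val_inj.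
have rs' : reduced s by apply: path_sorted rs.
pose l : F2 := @FreeGroup _ [:: x] isT.
have lE : FreeGroup rs = (l * FreeGroup rs')%g :> F2.
  by apply: val_inj; rewrite /= lpush_cons.
have [p hp pE] := IH (g * l)%g rs'; exists ((g * l)%g :: p).
  rewrite /= hp andbT; apply/asboolP; rewrite /l; case: x {rs lE pE hp l} => c [].
    by exists (fgen c); [case: c; [left | right] | left].
  exists (fgen c); [by case: c; [left | right] | right].
  rewrite -mulgA -[LHS]mulg1; congr (_ * _)%g.
  by apply: val_inj; rewrite /= /linv /= eqxx.
by rewrite /= pE lE mulgA.
Qed.

Definition cayley_F2 : graph :=
  Graph cayley_adj_sym cayley_adj_irrefl cayley_connected.

Section Metric.
Variables (R : realType) (X : metricType R).
Implicit Types (x y z : X) (A B : set X).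

(* A is the image of a geodesic from x to y. *)
Definition geodesic_segment x y A : Prop :=
  exists c : R -> X,
    [/\ c 0 = x, c (mdist x y) = y,
        {in `[0, mdist x y] &, forall s t, mdist (c s) (c t) = `|s - t|}
      & A = c @` `[0, mdist x y]].

(* For compact A, this is the set of p at distance at most r from A. *)
Definition cnbhd (r : R) A : set X :=
  [set p | exists2 q, A q & mdist p q <= r].

Definition hausdorff_close (r : R) A B : Prop :=
  A `<=` cnbhd r B /\ B `<=` cnbhd r A.

(* Geodesic, with uniformly slim geodesic triangles. As x, y, z are arbitrary
   and a segment from x to y is one from y to x, constraining the side A
   constrains all three sides. *)
Definition gromov_hyperbolic : Prop :=
  (forall x y, exists A, geodesic_segment x y A) /\
  exists2 delta : R, 0 <= delta &
    forall x y z A B C,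
      geodesic_segment x y A -> geodesic_segment y z B ->
      geodesic_segment x z C -> A `<=` cnbhd delta (B `|` C).

Definition quasiconvex A : Prop :=
  exists2 K : R, 0 <= K &
    forall x y S, A x -> A y -> geodesic_segment x y S -> S `<=` cnbhd K A.

(* The source is a set U with a distance function dU, for instance a group with
   a word metric. *)
Definition qi_embedding (U : Type) (dU : U -> U -> R) (f : U -> X) : Prop :=
  exists lambda eps : R, [/\ 1 <= lambda, 0 <= eps &
    forall u v, lambda^-1 * dU u v - eps <= mdist (f u) (f v)
                <= lambda * dU u v + eps].

End Metric.

Definition zpow (G : groupType) (g : G) (n : int) : G :=
  match n with Posz k => (g ^+ k)%g | Negz k => (g ^- k.+1)%g end.

Section Action.
Variables (R : realType) (G : groupType) (X : metricType R).
Variable act : G -> X -> X.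

Definition isometric_action : Prop :=
  [/\ forall x, act 1%g x = x,
      forall g h x, act (g * h)%g x = act g (act h x)
    & forall g x y, mdist (act g x) (act g y) = mdist x y].

Definition acylindrical : Prop :=
  forall r : R, 0 <= r ->
  exists (L : R) (M : nat), [/\ 1 <= L, (1 <= M)%N &
    forall x y, L <= mdist x y ->
      ([set g | mdist x (act g x) <= r /\ mdist y (act g y) <= r] #<= `I_M)%card].

(* For an isometric action the sequence converges and the limit does not depend
   on x; [limn] of a divergent real sequence would be 0. *)
Definition translation_length (x : X) (g : G) : R :=
  limn (fun n : nat => mdist x (act (g ^+ n)%g x) / n%:R).

(* The orbit maps of the cyclic group generated by g, parametrized by the
   integers, are quasi-isometric embeddings. *)
Definition loxodromic (g : G) : Prop :=
  forall x, qi_embedding (fun m n : int => `|m - n|%:~R)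
                         (fun n : int => act (zpow g n) x).

Definition purely_loxodromic : Prop := forall g : G, g != 1%g -> loxodromic g.

Definition metrically_proper : Prop :=
  forall (x : X) (r : R),
    finite_set [set g | ball x r `&` (act g @` ball x r) !=set0].

End Action.

(* Main.v *)
From mathcomp Require Import all_boot all_order all_algebra.
From mathcomp Require Import zify lra.
From mathcomp Require Import all_classical all_reals all_analysis.
Require Import Defs.

Set Implicit Arguments.
Unset Strict Implicit.
Unset Printing Implicit Defensive.

Import Order.TTheory GRing.Theory Num.Theory.
Import numFieldNormedType.Exports.

Local Open Scope classical_set_scope.
Local Open Scope ring_scope.

(** The graph is obtained from the Cayley tree of the free group by joining [x] to
    [x * v] for every word [v] of a suitable infinite language [L] of reduced
    words, containing the letters and closed under factors and inverses.

    Factor-closedness makes the distance in this graph a matter of combinatorics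
    on words: since multiplying reduced words only cancels, [x] and [y] are at
    distance at most [k] if and only if the reduced word of [x^-1 * y] is a
    concatenation of [k] words of [L] ([gdist_pieces]).  Cutting a word breaks at
    most one piece, so every vertex of the tree geodesic from [x] to [y] realizes
    the distance from [x] to [y] up to one unit.  Hence geodesics of the graph stay
    close to tree geodesics ([near_between]), and conversely a path with short
    jumps passes near every vertex of the tree geodesic between its ends, because
    a jump over a vertex in the tree is a piece that contains it
    ([between_near_path]).  Together these give hyperbolicity, as triangles of a
    tree are tripods, and the statement on geodesics of the Cayley graph; the
    latter is itself the graph of pieces of the words of length at most one.

    [L] consists of the factors of the period-doubling sequence and their
    inverses.  They get arbitrarily long, so that infinitely many group elements
    move the identity by one unit only: the action is not proper and orbit maps
    are not quasi-isometric embeddings.  On the other hand a word of [L] of period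
    [d] has length at most [5 * d] ([pd_lang_period]).  A power [c ^+ n] of a
    cyclically reduced element therefore has at least [n / 5] pieces, and
    translation lengths are at least [1 / 5].

    Acylindricity has the same source.  Suppose that many elements move two distant
    vertices [x] and [y] little.  Each maps the middle part of the tree geodesic
    from [x] to [y] into that geodesic, so the long word [u] along the middle part
    occurs in the word from [x] to [y] once for each of them.  These occurrences
    start within a stretch made of few pieces, which is a prefix of [u], while the
    lag between any two of them is a period of [u]; a short lag would force many
    pieces.  So the lags are at least a fixed fraction of the stretch, which bounds
    the number of occurrences ([lag_lower_bound], [sparse_card]).

    Passing from vertices to the geometric realization requires that distances
    between vertices are the combinatorial ones ([rdist_vertex]) and that geodesics
    exist ([geodesic_segment_exists]); both follow from the fact that a shortest
    path between two points leaves and enters their edges through ends of them, or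
    stays in a common edge ([chain_lower_bound]). *)

(** * The Cayley tree of a free group *)

Section Tree.
Variable T : choiceType.
Implicit Types (s t u v w : seq (T * bool)) (x y z m g h : freeGroup T).
Local Open Scope nat_scope.

Lemma fwordM g h : fword (g * h)%g = fmulw (fword g) (fword h).
Proof. by []. Qed.

Lemma fwordV g : fword g^-1%g = finvw (fword g).
Proof. by []. Qed.

Lemma reduced_fword g : reduced (fword g).
Proof. exact: valP g. Qed.

Lemma fword_inj : injective (@fword T).
Proof. exact: val_inj. Qed.

Lemma reduced_cat s t : reduced (s ++ t) -> reduced s /\ reduced t.
Proof. by case/cat_sorted2. Qed.

Lemma finvw_cat s t : finvw (s ++ t) = finvw t ++ finvw s.
Proof. by rewrite /finvw map_cat rev_cat. Qed.

Lemma size_finvw s : size (finvw s) = size s.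
Proof. by rewrite size_rev size_map. Qed.

Lemma fmulw_cat s t : reduced (s ++ t) -> fmulw s t = s ++ t.
Proof.
elim: s => //= x s IH rst; rewrite IH; last exact: path_sorted rst.
exact: lpush_cons.
Qed.

(** Multiplying two reduced words deletes a suffix of the first together with
    the inverse prefix of the second, and nothing else.  This is the tripod
    spanned by three vertices of the Cayley tree. *)
Lemma fmulw_cancel s t : reduced s -> reduced t ->
  exists a b c, [/\ s = a ++ c, t = finvw c ++ b & fmulw s t = a ++ b].
Proof.
move=> rs rt; elim: s rs => [|x s IH] rs; first by exists [::], t, [::].
have [a [b [c [sE tE mE]]]] := IH (path_sorted rs).
rewrite /= mE; case: a sE mE => [|y a] sE mE; last first.
  exists (x :: y :: a), b, c; split=> //=; first by rewrite sE.
  by move: rs; rewrite sE /reduced /= => /andP[/negbTE ->].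
case: b tE mE => [|y b] tE mE /=.
  by exists [:: x], [::], c; rewrite sE.
case: eqP => [yE|_]; last by exists [:: x], (y :: b), c; rewrite sE.
exists [::], b, (x :: c); split=> //; first by rewrite sE.
by rewrite tE yE /finvw /= rev_cons cat_rcons.
Qed.

(** The vertex [m] lies on the geodesic of the Cayley tree from [x] to [y]. *)
Definition between x m y : Prop :=
  fword (x^-1 * y)%g = fword (x^-1 * m)%g ++ fword (m^-1 * y)%g.

Lemma between_l x y : between x x y.
Proof. by rewrite /between mulVg. Qed.

Lemma between_r x y : between x y y.
Proof. by rewrite /between mulVg cats0. Qed.

Lemma fwordVM x y : fword (y^-1 * x)%g = finvw (fword (x^-1 * y)%g).
Proof. by rewrite -fwordV invgM invgK. Qed.

Lemma between_sym x m y : between x m y -> between y m x.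
Proof.
rewrite /between => b.
by rewrite (fwordVM x y) (fwordVM x m) (fwordVM m y) b finvw_cat.
Qed.

Lemma betweenMl g x m y : between x m y -> between (g * x)%g (g * m)%g (g * y)%g.
Proof.
by rewrite /between !invgM !mulgA -!(mulgA _ g^-1%g) !mulVg !mulg1.
Qed.

Lemma mulgVM x y z : ((x^-1 * y) * (y^-1 * z) = x^-1 * z)%g.
Proof. by rewrite mulgA mulgK. Qed.

Lemma between_prefix x y s t : fword (x^-1 * y)%g = s ++ t ->
  exists m, [/\ fword (x^-1 * m)%g = s, fword (m^-1 * y)%g = t & between x m y].
Proof.
move=> st; have := reduced_fword (x^-1 * y)%g; rewrite st => rst.
have [rs rt] := reduced_cat rst.
pose a := FreeGroup rs; pose b := FreeGroup rt.
have ab : (x^-1 * y = a * b)%g by apply: fword_inj; rewrite fwordM st fmulw_cat.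
exists (x * a)%g.
have aE : (x^-1 * (x * a) = a)%g by rewrite mulKg.
have bE : ((x * a)^-1 * y = b)%g by rewrite invgM -mulgA ab mulKg.
by rewrite /between aE bE st.
Qed.

Lemma between_inj x m n : fword (x^-1 * m)%g = fword (x^-1 * n)%g -> m = n.
Proof. by move/fword_inj/mulgI. Qed.

(** The branching point of the tripod of [fmulw_cancel]. *)
Lemma between_median x y z :
  exists m, [/\ between x m y, between x m z & between z m y].
Proof.
have [a [b [c [sE tE mE]]]] :=
  fmulw_cancel (reduced_fword (x^-1 * z)%g) (reduced_fword (z^-1 * y)%g).
have [m [xm mz bxz]] := between_prefix sE; exists m.
have yE : fword (x^-1 * y)%g = a ++ b by rewrite -(mulgVM x z y) fwordM mE.
have [m' [xm' my bxy]] := between_prefix yE.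
have mm' : m' = m by apply: (@between_inj x); rewrite xm xm'.
rewrite mm' in xm' my bxy.
by split=> //; rewrite /between my (fwordVM m z) mz.
Qed.

Lemma between_trans x m n y : between x n y -> between x m n -> between x m y.
Proof.
rewrite /between => ny mn; move: (ny); rewrite mn -catA.
by case/between_prefix => m' [/between_inj <- _].
Qed.

Lemma between_transr x m n y : between x m y -> between m n y -> between x n y.
Proof.
move=> /between_sym xy /between_sym mn.
exact: between_sym (between_trans xy mn).
Qed.

Lemma between_sub x m n y : between x n y -> between x m n -> between m n y.
Proof.
move=> ny mn; have := between_trans ny mn; rewrite {1}/between ny mn -catA.
by move/eqP; rewrite eqseq_cat // eqxx => /eqP.
Qed.

Lemma between_total x m n y : between x m y -> between x n y ->
  between x m n \/ between x n m.
Proof.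
wlog le_mn : m n / size (fword (x^-1 * m)%g) <= size (fword (x^-1 * n)%g).
  move=> W bm bn; have [le|/ltnW le] := leqP (size (fword (x^-1 * m)%g))
      (size (fword (x^-1 * n)%g)); first exact: W.
  by case: (W n m le bn bm); auto.
move=> bm bn; left; move: bn; rewrite {1}/between bm.
move=> /(congr1 (take (size (fword (x^-1 * n)%g)))).
rewrite [in RHS]take_size_cat // take_cat ltnNge le_mn /= => E.
have [m' [xm' m'n b]] := between_prefix (esym E).
by rewrite -(between_inj xm').
Qed.

(** Triangles of a tree are tripods: each side lies in the union of the other
    two. *)
Lemma between_triangle x y z m : between x m y -> between x m z \/ between z m y.
Proof.
move=> xmy; have [n [xny xnz zny]] := between_median x y z.
case: (between_total xmy xny) => [mn|nm].
  by left; apply: between_trans mn.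
by right; apply: between_transr (between_sub xmy nm).
Qed.

(** A path in a tree cannot avoid the geodesic between its ends; iterating
    [between_triangle] locates the segment of the path that meets a given vertex. *)
Lemma between_cover (c : nat -> freeGroup T) k m : between (c 0) m (c k) ->
  (m = c 0) \/ exists2 i, i < k & between (c i) m (c i.+1).
Proof.
elim: k => [|k IH] bm.
  left; move: bm; rewrite /between mulVg => /(congr1 size)/eqP.
  rewrite size_cat eq_sym addn_eq0 => /andP[/nilP/(@fword_inj (_ * _)%g 1%g) E _].
  by apply/esym/(mulgI (c 0)^-1%g); rewrite mulVg E.
case: (between_triangle (c k) bm) => [/IH[->|[i ik bi]]|bk]; first by left.
  by right; exists i => //; exact: ltnW.
by right; exists k.
Qed.

End Tree.

(** * Distances in graphs *)

Section GraphDistance.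
Variable Y : graph.
Implicit Types (u v w : Y) (n : nat).
Local Open Scope nat_scope.

Definition walk n u v : Prop :=
  exists p : seq Y, [/\ path (@adj Y) u p, last u p = v & size p = n].

Lemma walk_exists u v : exists n, `[< walk n u v >].
Proof.
by have [p up pv] := adj_connected u v; exists (size p); apply/asboolP; exists p.
Qed.

Definition gdist u v : nat := ex_minn (walk_exists u v).

Lemma gdistP u v : walk (gdist u v) u v.
Proof. by rewrite /gdist; case: ex_minnP => n /asboolP. Qed.

Lemma gdist_le n u v : walk n u v -> gdist u v <= n.
Proof. by rewrite /gdist; case: ex_minnP => m _ + /asboolP; apply. Qed.

Lemma walk_cat m n u v w : walk m u v -> walk n v w -> walk (m + n) u w.
Proof.
move=> [p [up <- <-]] [q [vq <- <-]]; exists (p ++ q).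
by rewrite cat_path up vq last_cat size_cat.
Qed.

Lemma walk_rev n u v : walk n u v -> walk n v u.
Proof.
move=> [p []]; elim: p n u => [|w p IH] n u /=; first by move=> _ <- <-; exists [::].
move=> /andP[uw wp] pv <-; rewrite -addn1; apply: walk_cat (IH _ _ wp pv erefl) _.
by exists [:: u]; rewrite /= andbT adj_sym.
Qed.

Lemma gdist_sym u v : gdist u v = gdist v u.
Proof.
by apply/eqP; rewrite eqn_leq; apply/andP; split; apply/gdist_le/walk_rev/gdistP.
Qed.

Lemma gdist_triangle v u w : gdist u w <= gdist u v + gdist v w.
Proof. exact: gdist_le (walk_cat (gdistP u v) (gdistP v w)). Qed.

Lemma gdistxx u : gdist u u = 0.
Proof. by apply/eqP; rewrite -leqn0; apply: gdist_le; exists [::]. Qed.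

Lemma gdist_adj u v : adj u v -> gdist u v <= 1.
Proof. by move=> uv; apply: gdist_le; exists [:: v]; rewrite /= uv. Qed.

End GraphDistance.

(** * Concatenations of words from a language *)

(** Requirements on the labels of the edges to be added to the Cayley tree.
    Closure under factors is what turns a shortest product of labels into a
    factorization of a reduced word; closure under inverses makes adjacency
    symmetric. *)
Record piece_language (T : choiceType) (L : seq (T * bool) -> Prop) : Prop := {
  lang_nil : L [::];
  lang_letter : forall x, L [:: x];
  lang_factor : forall u v w, L (u ++ v ++ w) -> L v;
  lang_inv : forall w, L w -> L (finvw w) }.

Lemma cat_eq_cat (A : Type) (u v p q : seq A) : u ++ v = p ++ q ->
  (exists r, u = p ++ r /\ q = r ++ v) \/ (exists r, p = u ++ r /\ v = r ++ q).
Proof.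
elim: u p => [|x u IH] [|y p] /=.
- by move=> ->; left; exists [::].
- by move=> ->; right; exists (y :: p).
- by move=> <-; left; exists (x :: u).
case=> -> /IH[[r [-> ->]]|[r [-> ->]]]; [left | right]; by exists r.
Qed.

Section Pieces.
Variables (T : choiceType) (L : seq (T * bool) -> Prop).
Hypothesis Llang : piece_language L.
Implicit Types (u v w : seq (T * bool)) (k l : nat).
Local Open Scope nat_scope.

(** Empty pieces are allowed, which makes the predicate monotone in [k]. *)
Fixpoint pieces k w : Prop :=
  if k is k'.+1 then exists u v, [/\ w = u ++ v, L u & pieces k' v]
  else w = [::].

Lemma pieces_le k l w : k <= l -> pieces k w -> pieces l w.
Proof.
move=> /subnK <-; elim: (l - k) => // i IH /IH wi.
by exists [::], w; split=> //; exact: lang_nil.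
Qed.

Lemma pieces1 w : L w -> pieces 1 w.
Proof. by move=> Lw; exists w, [::]; rewrite cats0. Qed.

Lemma pieces_cat k l u v : pieces k u -> pieces l v -> pieces (k + l) (u ++ v).
Proof.
elim: k u => [|k IH] u /=; first by move->.
by move=> [a [b [-> La kb]]] lv; exists a, (b ++ v); rewrite catA; split=> //; exact: IH.
Qed.

(** Cutting a word at one place breaks at most one of its pieces in two. *)
Lemma pieces_split k u v : pieces k (u ++ v) ->
  exists i j, [/\ i + j <= k.+1, pieces i u & pieces j v].
Proof.
elim: k u => [|k IH] u /=.
  by move/nilP; rewrite /nilp size_cat addn_eq0 => /andP[/nilP-> /nilP->]; exists 0, 0.
move=> [p [q [/cat_eq_cat[[r [-> ->]]|[r [-> ->]]] Lp kq]]].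
  have [i [j [ij ri jv]]] := IH _ kq.
  by exists i.+1, j; split=> //; exists p, r.
exists 1, k.+1; split; first by rewrite add1n.
  by apply: pieces1; apply: (lang_factor Llang (u := [::])) Lp.
exists r, q; split=> //.
by apply: (lang_factor Llang (u := u) (w := [::])); rewrite cats0.
Qed.

Lemma pieces_prefix k u v : pieces k (u ++ v) -> pieces k u.
Proof.
elim: k u => [|k IH] u /=.
  by move/nilP; rewrite /nilp size_cat addn_eq0 => /andP[/nilP->].
move=> [p [q [/cat_eq_cat[[r [-> ->]]|[r [-> _]]] Lp kq]]].
  by exists p, r; split=> //; exact: IH kq.
apply: (@pieces_le 1 k.+1) => //; apply: pieces1.
exact: (lang_factor Llang (u := [::])) Lp.
Qed.

Lemma pieces_rcons k w : pieces k.+1 w ->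
  exists u v, [/\ w = u ++ v, pieces k u & L v].
Proof.
elim: k w => [|k IH] w.
  by case=> u [v [-> Lu ->]]; exists [::], u; rewrite cats0.
case=> p [q [-> Lp /IH[u [v [-> ku Lv]]]]].
by exists (p ++ u), v; rewrite catA; split=> //; exists p, u.
Qed.

Lemma pieces_inv k w : pieces k w -> pieces k (finvw w).
Proof.
elim: k w => [|k IH] w; first by move->.
move=> [u [v [-> Lu /IH kv]]]; rewrite finvw_cat -addn1.
by apply: pieces_cat kv _; apply: pieces1; apply: lang_inv.
Qed.

Lemma pieces_suffix k u v : pieces k (u ++ v) -> pieces k v.
Proof.
by move=> /pieces_inv; rewrite finvw_cat => /pieces_prefix/pieces_inv; rewrite finvwK.
Qed.

(** Cancellation costs nothing: by factor-closedness it only shortens pieces. *)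
Lemma piecesM k l (g h : freeGroup T) : pieces k (fword g) -> pieces l (fword h) ->
  pieces (k + l) (fword (g * h)%g).
Proof.
have [a [b [c [gE hE ghE]]]] := fmulw_cancel (reduced_fword g) (reduced_fword h).
rewrite fwordM ghE gE hE => /pieces_prefix ka /pieces_suffix lb.
exact: pieces_cat.
Qed.

End Pieces.

(** * The graph of pieces *)

Section PieceGraph.
Variables (T : choiceType) (L : seq (T * bool) -> Prop).
Hypothesis Llang : piece_language L.
Variables (e : rel (freeGroup T)) (e_sym : symmetric e) (e_irr : irreflexive e).
Hypothesis e_conn : forall x y, exists2 p, path e x p & last x p = y.
Hypothesis eP : forall x y, e x y <-> x <> y /\ L (fword (x^-1 * y)%g).
Local Open Scope nat_scope.

Let Y : graph := Graph e_sym e_irr e_conn.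
Local Notation d := (@gdist Y).
Implicit Types x y z m : freeGroup T.

(** The labels along a path multiply to an element whose reduced word has no more
    pieces than the path has edges, by [piecesM]; conversely a factorization of
    the reduced word is a path that follows the tree. *)
Lemma gdist_pieces x y k : d x y <= k <-> pieces L k (fword (x^-1 * y)%g).
Proof.
split=> [xyk|].
  apply: (pieces_le Llang xyk).
  case: (gdistP (Y := Y) x y) => p []; elim: p x {xyk} (d x y) => [|z p IH] x n.
    by move=> _ <- <-; rewrite mulVg.
  rewrite [path _ _ _]/=; move=> /andP[/eP[_ Lxz] zp] py <-.
  rewrite -(mulgVM x z) [size _]/= -add1n.
  apply: piecesM => //; first exact: pieces1.
  exact: IH zp py _.
elim: k x => [|k IH] x.
  move=> /(@fword_inj _ _ 1%g) xy.
  have <- : x = y by apply: (mulgI x^-1%g); rewrite mulVg xy.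
  by rewrite gdistxx.
move=> [u [v [/between_prefix[m [xm my b]] Lu kv]]].
have xm1 : d x m <= 1.
  have [<-|/eqP xNm] := eqVneq x m; first by rewrite gdistxx.
  by apply: gdist_adj; apply/eP; split=> //; rewrite xm.
apply: leq_trans (gdist_triangle (m : Y) _ _) _; rewrite -add1n leq_add //.
by apply: IH; rewrite my.
Qed.

Lemma gdist_piecesP x y : pieces L (d x y) (fword (x^-1 * y)%g).
Proof. exact/gdist_pieces. Qed.

Lemma gdistMl g x y : d (g * x)%g (g * y)%g = d x y.
Proof.
have E : ((g * x)^-1 * (g * y) = x^-1 * y)%g by rewrite invgM -mulgA mulKg.
by apply/eqP; rewrite eqn_leq; apply/andP; split; apply/gdist_pieces;
   [rewrite E | rewrite -E]; exact: gdist_piecesP.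
Qed.

Lemma between_gdistl x m y : between x m y -> d x m <= d x y.
Proof.
move=> b; apply/gdist_pieces/(pieces_prefix Llang (v := fword (m^-1 * y)%g)).
rewrite -b; exact: gdist_piecesP.
Qed.

Lemma between_gdistr x m y : between x m y -> d m y <= d x y.
Proof.
by rewrite (gdist_sym (m : Y)) (gdist_sym (x : Y)) => /between_sym; exact: between_gdistl.
Qed.

(** Cutting the word at [m] breaks one piece at most, so that vertices of the tree
    geodesic almost realize the distance. *)
Lemma between_gdistD x m y : between x m y -> d x m + d m y <= (d x y).+1.
Proof.
move=> b; have := gdist_piecesP x y; rewrite b => /(pieces_split Llang).
move=> [i [j [ij /gdist_pieces xm /gdist_pieces my]]].
by apply: leq_trans ij; exact: leq_add.
Qed.

(** Removing the last piece of a shortest factorization lowers the distance by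
    exactly one. *)
Lemma between_at x y k : k <= d x y -> exists2 m, between x m y & d x m = k.
Proof.
move En: (d x y) => n; elim: n y En => [|n IH] y xyn.
  by rewrite leqn0 => /eqP ->; exists x; [exact: between_l | exact: gdistxx].
rewrite leq_eqVlt ltnS => /predU1P[->|kn]; first by exists y => //; exact: between_r.
have := gdist_piecesP x y; rewrite xyn => /pieces_rcons[u [v [uv ku Lv]]].
have [m [xm my b]] := between_prefix uv.
have xmn : d x m <= n by apply/gdist_pieces; rewrite xm.
have my1 : d m y <= 1 by apply/gdist_pieces; rewrite my; exact: pieces1.
have [|m' b' xm'] := IH m _ kn; last by exists m' => //; exact: between_trans b'.
apply/eqP; rewrite eqn_leq xmn -ltnS -xyn.
by apply: leq_trans (gdist_triangle (m : Y) _ _) _; rewrite -addn1 leq_add2l.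
Qed.

(** A vertex that is almost on a geodesic of the graph of pieces is close to the
    tree geodesic: its distance to the tree geodesic is half the defect in the
    triangle inequality, because both halves of the tripod almost add up. *)
Lemma near_between x y z c : d x z + d z y <= d x y + c ->
  exists2 m, between x m y & (d z m).*2 <= c + 2.
Proof.
move=> xyc; have [m [xmy xmz zmy]] := between_median x y z; exists m => //.
have := between_gdistD xmz; have := between_gdistD zmy.
have := gdist_triangle (m : Y) x y; rewrite (gdist_sym (m : Y) z) -addnn; lia.
Qed.

(** Some jump of the path passes over [m] in the tree, and by factor-closedness
    [m] is then no farther from the start of the jump than its end is. *)
Lemma between_near_path (v : nat -> freeGroup T) k c m :
  (forall i, i < k -> d (v i) (v i.+1) <= c) -> between (v 0) m (v k) ->
  exists2 i, i <= k & d m (v i) <= c.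
Proof.
move=> vc /between_cover[->|[i ik b]]; first by exists 0; rewrite ?gdistxx.
exists i; first exact: ltnW.
by rewrite gdist_sym; apply: leq_trans (between_gdistl b) (vc _ ik).
Qed.

End PieceGraph.

(** * Periods of words *)

Section Periods.
Variable T : choiceType.
Implicit Types (u v w : seq (T * bool)) (d k i : nat).
Local Open Scope nat_scope.

Definition has_period d w : Prop :=
  forall x0 i, i + d < size w -> nth x0 w i = nth x0 w (i + d).

Lemma has_period_factor d u v w : has_period d (u ++ v ++ w) -> has_period d v.
Proof.
move=> uvw x0 i idv; have := uvw x0 (size u + i).
rewrite !size_cat !nth_cat -addnA !ltnNge !leq_addr /= !addKn -!ltnNge idv.
by rewrite (leq_ltn_trans (leq_addr d i) idv) ltn_add2l ltn_addr // => ->.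
Qed.

Lemma has_period_inv d w : has_period d w -> has_period d (finvw w).
Proof.
move=> wd x0 i; rewrite size_finvw => idw.
have iw : i < size w by apply: leq_ltn_trans idw; exact: leq_addr.
rewrite !nth_rev ?size_map // -(linvK x0).
rewrite !(nth_map (linv x0)) ?ltn_subrL ?(leq_ltn_trans _ idw) //.
congr (linv _); rewrite [RHS]wd; last by lia.
by congr nth; lia.
Qed.

(** Two overlapping occurrences of a word make it periodic. *)
Lemma has_period_occurrences w u s s' : s <= s' ->
  take (size u) (drop s w) = u -> take (size u) (drop s' w) = u ->
  has_period (s' - s) u.
Proof.
move=> ss' us us' x0 i idu.
have nth_u r j : take (size u) (drop r w) = u -> j < size u ->
    nth x0 u j = nth x0 w (r + j).
  by move=> ur ju; rewrite -{1}ur nth_take // nth_drop.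
by rewrite (nth_u s') // ?(nth_u s) //; [congr nth; lia | lia].
Qed.

Lemma pieces_period_size (L : seq (T * bool) -> Prop) q d k w :
  (forall v, L v -> has_period d v -> size v <= q * d) ->
  pieces L k w -> has_period d w -> size w <= q * d * k.
Proof.
move=> Lper; elim: k w => [|k IH] w; first by move->.
move=> [u [v [-> Lu kv]]] per; rewrite size_cat mulnS leq_add //.
  by apply: Lper => //; apply: (has_period_factor (u := [::]) per).
by apply: IH => //; apply: (has_period_factor (u := u) (w := [::])); rewrite cats0.
Qed.

End Periods.

(** * An aperiodic language of labels *)

Section PeriodDoubling.
Implicit Types (w : seq (bool * bool)) (d i n : nat).
Local Open Scope nat_scope.

(** The period-doubling sequence, spelled with the two positive generators: all
    its factors are then reduced words.  Its index is shifted by one because the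
    valuation is that of a positive integer. *)
Definition pd_letter i : bool * bool := (odd (logn 2 i.+1), true).

Definition pd_word i n : seq (bool * bool) := map pd_letter (iota i n).

Definition pd_lang w : Prop :=
  exists i n, w = pd_word i n \/ w = finvw (pd_word i n).

Lemma size_pd_word i n : size (pd_word i n) = n.
Proof. by rewrite size_map size_iota. Qed.

Lemma pd_word_factor i n u v w : pd_word i n = u ++ v ++ w ->
  v = pd_word (i + size u) (size v).
Proof.
move=> E; have : n = size u + (size v + size w) by rewrite -(size_pd_word i n) E !size_cat.
move: E => /[swap] ->; rewrite /pd_word !iotaD !map_cat => /eqP.
rewrite eqseq_cat ?size_map ?size_iota // => /andP[_].
by rewrite eqseq_cat ?size_map ?size_iota // => /andP[/eqP ->].
Qed.

Lemma reduced_pd_word i n : reduced (pd_word i n).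
Proof.
elim: n i => [//|[//|n] IH] i.
by apply/andP; split; [rewrite xpair_eqE andbF | exact: (IH i.+1)].
Qed.

Lemma pd_piece_language : piece_language pd_lang.
Proof.
split.
- by exists 0, 0; left.
- have l0 : pd_letter 0 = (false, true) by rewrite /pd_letter logn1.
  have l1 : pd_letter 1 = (true, true) by rewrite /pd_letter (pfactorK 1).
  by case=> [[] []]; [exists 1, 1; left | exists 1, 1; right
    | exists 0, 1; left | exists 0, 1; right]; rewrite /pd_word /= ?l0 ?l1.
- move=> u v w [i [n [E|E]]].
    by exists (i + size u), (size v); left; exact: pd_word_factor (esym E).
  move: E => /(congr1 (@finvw _)); rewrite finvwK !finvw_cat -catA => /esym E.
  exists (i + size (finvw w)), (size (finvw v)); right.
  by rewrite -(pd_word_factor E) finvwK.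
- move=> w [i [n [->|->]]]; exists i, n; first by right.
  by left; rewrite finvwK.
Qed.

(** The sequence disagrees with each of its shifts at bounded distance.  Write the
    shift as [2 ^ k * m] with [m] odd.  Any four consecutive multiples
    of [2 ^ k] contain [2 ^ k * q] with [q + m = 2] modulo 4; there the 2-adic
    valuation is [k], and [k + 1] after the shift. *)
Lemma pd_letter_shift i d : 0 < d ->
  exists2 j, i <= j < i + 4 * d & pd_letter j <> pd_letter (j + d).
Proof.
move=> d0; have [m m_odd dE] := @pfactor_coprime 2 d isT d0.
rewrite coprime2n in m_odd; move: dE; move: (logn 2 d) => k dE.
have k0 : 0 < 2 ^ k by rewrite expn_gt0.
(* The multiple [q * 2 ^ k] is the value of [j + 1]. *)
pose a := i %/ 2 ^ k.
have [q /andP[aq qa] qm] : exists2 q, a < q <= a + 4 & (q + m) %% 4 = 2.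
  have [r [r0 r4 rE]] : exists r, [/\ 0 < r, r <= 4 & (a + r + m) %% 4 = 2].
    have : (a + m) %% 4 < 4 by rewrite ltn_mod.
    by case E : ((a + m) %% 4) => [|[|[|[|//]]]] _;
       [exists 2 | exists 1 | exists 4 | exists 3]; split=> //; lia.
  by exists (a + r) => //; lia.
have q_odd : odd q by move: m_odd; lia.
have iE : i = a * 2 ^ k + i %% 2 ^ k by exact: divn_eq.
have ik : i %% 2 ^ k < 2 ^ k by rewrite ltn_mod.
have m0 : 0 < m by case: (m) m_odd.
have jE : (q * 2 ^ k).-1.+1 = q * 2 ^ k by rewrite prednK // muln_gt0 k0; lia.
exists (q * 2 ^ k).-1.
  have : a.+1 * 2 ^ k <= q * 2 ^ k by rewrite leq_mul2r aq orbT.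
  have : q * 2 ^ k <= (a + 4) * 2 ^ k by rewrite leq_mul2r qa orbT.
  have : 2 ^ k <= d by rewrite dE leq_pmull.
  by rewrite mulSn mulnDl; lia.
have [c cE] : exists c, q + m = 2 * c /\ odd c.
  by exists ((q + m) %/ 2); split; lia.
rewrite /pd_letter -addSn jE dE -mulnDl => -[].
rewrite !lognM ?pfactorK //; try lia.
rewrite cE.1 lognM ?(pfactorK 1) //; try lia.
rewrite !logn_coprime ?coprime2n ?cE.2 //.
by rewrite add0n addn0 add1n /=; case: (odd k).
Qed.

Lemma pd_word_period i n d : 0 < d -> has_period d (pd_word i n) -> n <= 5 * d.
Proof.
move=> d0 per; rewrite leqNgt; apply/negP => dn.
have [j jd] := pd_letter_shift i d0; apply.
have := per (pd_letter 0) (j - i); rewrite size_pd_word.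
rewrite !(nth_map 0) ?size_iota ?nth_iota; try lia.
have -> : i + (j - i) = j by lia.
have -> : i + (j - i + d) = j + d by lia.
by apply; lia.
Qed.

Lemma pd_lang_period d w : 0 < d -> pd_lang w -> has_period d w -> size w <= 5 * d.
Proof.
move=> d0 [i [n [->|->]]]; rewrite ?size_finvw size_pd_word => per.
  exact: pd_word_period d0 per.
by apply: (@pd_word_period i) d0 _; rewrite -(finvwK (pd_word i n)); exact: has_period_inv.
Qed.

End PeriodDoubling.

(** * The metric of the geometric realization *)

Section Realization.
Variables (R : realType) (Y : graph).
Implicit Types (u v w : Y) (s t l : R) (p q r : realization R Y).

Lemma edge_ptC u v t : edge_pt u v t = edge_pt v u (1 - t).
Proof. by apply: funext => w; rewrite /edge_pt subKr addrC. Qed.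

Lemma coord_rvertex u : coord (rvertex R u) = edge_pt u u 0.
Proof. by []. Qed.

Lemma adj_neq u v : adj u v -> (u == v) = false.
Proof. by move=> uv; apply/eqP => E; rewrite E adj_irrefl in uv. Qed.

Lemma edge_ptl u v t : u == v = false -> edge_pt u v t u = 1 - t.
Proof. by move=> uv; rewrite /edge_pt eqxx uv mulr1 mulr0 addr0. Qed.

Lemma edge_ptr u v t : u == v = false -> edge_pt u v t v = t.
Proof. by move=> uv; rewrite /edge_pt eqxx eq_sym uv mulr1 mulr0 add0r. Qed.

Lemma edge_pt_inj u v s t : u == v = false -> edge_pt u v s = edge_pt u v t -> s = t.
Proof. by move=> uv /(congr1 (fun f => f v)); rewrite !edge_ptr. Qed.

(** Barycentric coordinates determine the edge and the position on it, except
    that a vertex lies on all the edges around it. *)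
Lemma edge_pt_eq u v t u' v' t' : adj u v -> adj u' v' ->
  0 <= t <= 1 -> 0 <= t' <= 1 -> edge_pt u v t = edge_pt u' v' t' ->
  [\/ [/\ u' = u, v' = v & t' = t], [/\ u' = v, v' = u & t' = 1 - t]
    | exists w, (w = u /\ t = 0 \/ w = v /\ t = 1) /\
                (w = u' /\ t' = 0 \/ w = v' /\ t' = 1)].
Proof.
move=> /adj_neq uv /adj_neq uv' ht ht' E.
have Eu : edge_pt u' v' t' u = 1 - t by rewrite -E edge_ptl.
have Ev : edge_pt u' v' t' v = t by rewrite -E edge_ptr.
have [t0|t0] := eqVneq t 0.
  apply: Or33; exists u; split; first by left.
  move: Eu; rewrite t0 /edge_pt; case: eqP => [->|_]; case: eqP => [E2|_].
  - by rewrite E2 eqxx in uv'.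
  - by rewrite mulr1 mulr0 => ?; left; split=> //; lra.
  - by rewrite mulr1 mulr0 => ?; right; split=> //; lra.
  - by rewrite !mulr0 => ?; exfalso; lra.
have [t1|t1] := eqVneq t 1.
  apply: Or33; exists v; split; first by right.
  move: Ev; rewrite t1 /edge_pt; case: eqP => [->|_]; case: eqP => [E2|_].
  - by rewrite E2 eqxx in uv'.
  - by rewrite mulr1 mulr0 => ?; left; split=> //; lra.
  - by rewrite mulr1 mulr0 => ?; right; split=> //; lra.
  - by rewrite !mulr0 => ?; exfalso; lra.
have {}t1 : 1 - t != 0 by rewrite subr_eq0 eq_sym.
move: Eu Ev; rewrite /edge_pt.
case: (eqVneq u u') => [uu'|_]; case: (eqVneq u v') => [uv''|_].
- by rewrite -uu' -uv'' eqxx in uv'.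
- move: uv; rewrite uu' => uv; rewrite eq_sym uv /= mulr1 mulr0 addr0 mulr0 add0r.
  case: eqP => [->|_] Eu Ev; last by rewrite mulr0 in Ev; rewrite -Ev eqxx in t0.
  by apply: Or31; split=> //; lra.
- move: uv; rewrite uv'' => uv; rewrite [v == v']eq_sym uv /= mulr1 !mulr0 addr0 add0r.
  case: eqP => [->|_] Eu Ev; last by rewrite mulr0 in Ev; rewrite -Ev eqxx in t0.
  by apply: Or32; split=> //; lra.
- by rewrite !mulr0 addr0 => Eu; rewrite -Eu eqxx in t1.
Qed.

Lemma chain_edge u v s t p q : adj u v -> 0 <= s <= 1 -> 0 <= t <= 1 ->
  coord p = edge_pt u v s -> coord q = edge_pt u v t -> chain p q `|s - t|.
Proof.
move=> uv hs ht pE qE; rewrite -[`|_|]add0r.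
exact: chain_rcons uv hs ht pE qE (chain_nil _).
Qed.

Lemma chain_walk n u v : walk n u v -> chain (rvertex R u) (rvertex R v) n%:R.
Proof.
move=> [s [us <- <-]]; elim: s u us => [|w s IH] u /=; first by constructor.
move=> /andP[uw /IH ws]; rewrite -add1n natrD; apply: chain_cat ws.
have -> : 1%:R = `|0 - 1| :> R by rewrite sub0r normrN1.
apply: (chain_edge uw); rewrite ?lexx ?ler01 ?coord_rvertex //.
  by rewrite edge_pt0.
by rewrite edge_pt1.
Qed.

Lemma chain_neq_edge p q l : chain p q l -> p <> q ->
  exists u v t, [/\ adj u v, 0 <= t <= 1 & coord q = edge_pt u v t].
Proof.
case=> [//|u v s t q' r {}l uv _ ht _ rE _] _.
by exists u, v, t.
Qed.

Section FromEdgePoint.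
Variables (u0 v0 : Y) (s0 : R) (p : realization R Y).
Hypotheses (uv0 : adj u0 v0) (hs0 : 0 <= s0 <= 1) (pE : coord p = edge_pt u0 v0 s0).

(** The distance from [p], on the edge [u0 v0], to the vertex [w]: a path leaves
    the edge through one of its ends. *)
Let D w : R := Num.min (s0 + (gdist u0 w)%:R) (1 - s0 + (gdist v0 w)%:R).

Lemma chain_to_vertex w : chain p (rvertex R w) (D w).
Proof.
rewrite /D; have zero : 0 <= (0 : R) <= 1 by lra.
have one : 0 <= (1 : R) <= 1 by lra.
case: (lerP (s0 + (gdist u0 w)%:R)) => _.
  apply: chain_cat (chain_walk (gdistP u0 w)).
  have -> : s0 = `|s0 - 0| by rewrite subr0 ger0_norm //; case/andP: hs0.
  by apply: (chain_edge uv0) => //; rewrite coord_rvertex edge_pt0.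
apply: chain_cat (chain_walk (gdistP v0 w)).
have -> : 1 - s0 = `|s0 - 1|.
  by rewrite distrC ger0_norm // subr_ge0; case/andP: hs0.
by apply: (chain_edge uv0) => //; rewrite coord_rvertex edge_pt1.
Qed.

Lemma dist_to_vertex_adj w w' : adj w w' -> D w' <= D w + 1.
Proof.
move=> ww'; have h u : (gdist u w')%:R <= (gdist u w)%:R + 1 :> R.
  rewrite natr1 ler_nat -addn1; apply: leq_trans (gdist_triangle w _ _) _.
  by rewrite leq_add2l gdist_adj.
by rewrite /D addr_minl le_min !ge_min -!addrA !lerD2l !h orbT.
Qed.

Lemma dist_to_vertex_edge u v s : adj u v -> 0 <= s <= 1 ->
  coord p = edge_pt u v s -> D u <= s /\ D v <= 1 - s.
Proof.
move=> uv hs; rewrite pE => /edge_pt_eq -/(_ uv0 uv hs0 hs).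
have D0 : D u0 <= s0 by rewrite /D ge_min gdistxx addr0 lexx.
have D1 : D v0 <= 1 - s0 by rewrite /D ge_min gdistxx addr0 lexx orbT.
have := dist_to_vertex_adj uv; have vu : adj v u by rewrite adj_sym.
have := dist_to_vertex_adj vu => Dvu Duv.
case=> [[-> -> ->]|[-> -> ->]|[w [Ew Ew']]]; rewrite ?subKr //.
have Dw : D w <= 0 by case: Ew => -[-> E]; [rewrite E in D0 | rewrite E subrr in D1].
by case: Ew' => -[E ->]; rewrite E in Dw; split; lra.
Qed.

(** A lower bound for the length of a path from [p] to a point on the edge
    [u v]: the path stays in that edge or enters it through one of its ends. *)
Lemma chain_lower_bound q l : chain p q l -> forall u v t, adj u v -> 0 <= t <= 1 ->
  coord q = edge_pt u v t ->
  [\/ D u + t <= l, D v + (1 - t) <= l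
    | exists s, [/\ 0 <= s <= 1, coord p = edge_pt u v s & `|s - t| <= l]].
Proof.
elim=> [|u v s t {}q r {}l uv hs ht qE rE _ IH] u' v' t' uv' ht' E.
  by apply: Or33; exists t'; rewrite subrr normr0.
have vu : adj v u by rewrite adj_sym.
have Dvu := dist_to_vertex_adj vu; have Duv := dist_to_vertex_adj uv.
have st : t - s <= `|s - t| /\ s - t <= `|s - t|.
  by rewrite ler_norm distrC ler_norm.
have H : [\/ D u + t <= l + `|s - t|, D v + (1 - t) <= l + `|s - t|
    | exists s', [/\ 0 <= s' <= 1, coord p = edge_pt u v s'
        & `|s' - t| <= l + `|s - t|]].
  case: (IH _ _ _ uv hs qE) => [h|h|[s' [hs' pE' h]]].
  - by apply: Or31; lra.
  - by apply: Or32; lra.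
  - apply: Or33; exists s'; split=> //.
    by apply: le_trans (ler_distD s _ _) _; rewrite lerD2r.
move: {IH} (l + _) H => {}l H; rewrite rE in E.
case: (edge_pt_eq uv uv' ht ht' E) => [[-> -> ->]|[-> -> ->]|[w [Ew Ew']]].
- exact: H.
- case: H => h; [apply: Or32 | apply: Or31 | apply: Or33]; rewrite ?subKr //.
  case: h => s' [hs' pE' h]; exists (1 - s'); split; first by lra.
    by rewrite edge_ptC subKr.
  by move: h; rewrite distrC; congr (`|_| <= _); lra.
have Dw : D w <= l.
  case: H => [h|h|[s' [hs' /dist_to_vertex_edge -/(_ uv hs')[D1 D2] h]]].
  - by case: Ew => -[-> tE]; rewrite tE in h; lra.
  - by case: Ew => -[-> tE]; rewrite tE in h; lra.
  - have := ler_norm (s' - t); have := ler_norm (t - s'); rewrite distrC.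
    by case: Ew => -[-> tE]; rewrite tE in h *; lra.
by case: Ew' => -[E' ->]; rewrite E' in Dw; [apply: Or31 | apply: Or32]; lra.
Qed.

End FromEdgePoint.

(** The infimum that defines the distance is attained, because only three
    lengths compete for it. *)
Lemma chain_rdist p q : chain p q (rdist p q).
Proof.
have [<-|/eqP pq] := eqVneq p q; first by rewrite rdist_xx; exact: chain_nil.
have [l0 pql0] := chain_ex p q.
have [u0 [v0 [s0 [uv0 hs0 pE]]]] := chain_neq_edge (chain_sym pql0) (nesym pq).
have [u [v [t [uv ht qE]]]] := chain_neq_edge pql0 pq.
have toq w s : chain p (rvertex R w) s ->
    (w = u -> chain p q (s + t)) /\ (w = v -> chain p q (s + (1 - t))).
  move=> pw; split=> wE; apply: (chain_cat pw); rewrite wE.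
    have -> : t = `|0 - t| by rewrite distrC subr0 ger0_norm //; case/andP: ht.
    by apply: (chain_edge uv) => //; rewrite ?lexx ?ler01 // coord_rvertex edge_pt0.
  have -> : 1 - t = `|1 - t| by rewrite ger0_norm // subr_ge0; case/andP: ht.
  by apply: (chain_edge uv) => //; rewrite ?lexx ?ler01 // coord_rvertex edge_pt1.
have [+ _] := toq _ _ (chain_to_vertex uv0 hs0 pE u).
have [_ +] := toq _ _ (chain_to_vertex uv0 hs0 pE v).
have lb := chain_lower_bound uv0 hs0 pE _ uv ht qE.
move: lb; set e1 := Num.min _ _ + t; set e2 := Num.min _ _ + (1 - t).
move=> lb /(_ erefl) c2 /(_ erefl) c1.
pose e12 := Num.min e1 e2.
have c12 : chain p q e12 by rewrite /e12; case: (lerP e1 e2).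
suff [e pqe ple] : exists2 e, chain p q e & forall l, chain p q l -> e <= l.
  suff -> : rdist p q = e by [].
  by apply/eqP; rewrite eq_le rdist_le // rdist_lb.
have [[s [hs sE]]|noE] := pselect (exists s, 0 <= s <= 1 /\ coord p = edge_pt u v s).
  exists (Num.min e12 `|s - t|).
    by case: (lerP e12 `|s - t|) => _ //; exact: chain_edge uv hs ht sE qE.
  move=> l /lb[h|h|[s' [_ sE' h]]]; rewrite !ge_min ?h ?orbT //.
  by rewrite (edge_pt_inj (adj_neq uv) (etrans (esym sE) sE')) h orbT.
exists e12 => // l /lb[h|h|[s [hs sE _]]]; rewrite ?ge_min ?h ?orbT //.
by case: noE; exists s.
Qed.

Lemma rdist_edge u v s t p q : adj u v -> 0 <= s <= 1 -> 0 <= t <= 1 ->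
  coord p = edge_pt u v s -> coord q = edge_pt u v t -> rdist p q <= `|s - t|.
Proof. by move=> uv hs ht pE qE; apply: rdist_le; exact: chain_edge pE qE. Qed.

Lemma rdist_vertex u v : rdist (rvertex R u) (rvertex R v) = (gdist u v)%:R.
Proof.
apply/eqP; rewrite eq_le rdist_le /=; last exact: chain_walk (gdistP u v).
have [->|/eqP uNv] := eqVneq u v; first by rewrite gdistxx rdist_xx.
have zero : 0 <= (0 : R) <= 1 by lra.
have edge_at w w' : w <> w' -> exists w'', adj w w''.
  case: (adj_connected w w') => -[|w'' s] /=; first by move=> _ ->.
  by case/andP => ww'' _ _ _; exists w''.
have [u' uu'] := edge_at _ _ uNv; have [v' vv'] := edge_at _ _ (nesym uNv).
have pE : coord (rvertex R u) = edge_pt u u' 0 by rewrite edge_pt0.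
have qE : coord (rvertex R v) = edge_pt v v' 0 by rewrite edge_pt0.
have gu w : (gdist u w)%:R <=
    Num.min (0 + (gdist u w)%:R) (1 - 0 + (gdist u' w)%:R) :> R.
  rewrite le_min add0r lexx subr0 /= nat1r ler_nat -add1n.
  by apply: leq_trans (gdist_triangle u' _ _) _; rewrite leq_add2r gdist_adj.
have gv := dist_to_vertex_edge uu' zero pE vv'.
apply: rdist_lb => l /chain_lower_bound-/(_ _ _ _ uu' zero pE _ _ _ vv' zero qE).
case=> [h|h|[s [hs /(gv _ hs)[h _]]]].
- by rewrite addr0 in h; exact: le_trans (gu v) h.
- apply: le_trans (gu v) _; have e : (1 - 0 : R) = 1 by rewrite subr0.
  rewrite [X in _ + X]e in h; apply: le_trans h.
  by apply: dist_to_vertex_adj; rewrite adj_sym.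
- by rewrite subr0 ger0_norm; [exact: le_trans (le_trans (gu v) h) | case/andP: hs].
Qed.

Lemma near_vertex p : exists u, rdist p (rvertex R u) <= 1.
Proof.
have [u [v [t [uv ht pE]]]] := coordP p; exists u; case: uv => [uv|uv].
  suff -> : p = rvertex R u by rewrite rdist_xx.
  by apply: coord_inj; rewrite pE -uv edge_ptxx.
apply: (@le_trans _ _ `|t - 0|); last by rewrite subr0 ger0_norm; case/andP: ht.
by apply: rdist_edge uv ht _ pE _; rewrite ?lexx ?ler01 // coord_rvertex edge_pt0.
Qed.

Lemma clamp_lipschitz (a x y : R) : x <= y ->
  0 <= Num.min (Num.max y 0) a - Num.min (Num.max x 0) a <= y - x.
Proof.
move=> xy; have : 0 <= Num.max y 0 - Num.max x 0 <= y - x.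
  by case: (lerP x 0) => ?; case: (lerP y 0) => ?; lra.
move: (Num.max y 0) (Num.max x 0) => y' x' yx'.
by case: (lerP x' a) => ?; case: (lerP y' a) => ?; lra.
Qed.

(** Resting at its ends makes the curve 1-Lipschitz on the whole line, so that
    concatenation needs no side conditions. *)
Lemma chain_curve p q l : chain p q l ->
  exists c : R -> realization R Y,
    [/\ forall x, x <= 0 -> c x = p, forall x, l <= x -> c x = q
      & forall x y, x <= y -> rdist (c x) (c y) <= y - x].
Proof.
elim=> [|u v s t {}q r {}l uv hs ht qE rE pql [c [c0 cl clip]]].
  by exists (fun=> p); split=> // x y; rewrite rdist_xx subr_ge0.
pose a := `|s - t|; have a0 : 0 <= a by exact: normr_ge0.
(* The position on the edge [u v], moving at unit speed from [s] to [t]. *)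
pose z x := s + Num.sg (t - s) * Num.min (Num.max x 0) a.
have hz x : 0 <= z x <= 1.
  rewrite /z /a distrC.
  have : 0 <= Num.min (Num.max x 0) `|t - s| <= `|t - s|.
    by rewrite ge_min lexx orbT le_min normr_ge0 le_max lexx orbT.
  by case: (sgrP (t - s)) => h; lra.
have zpt x : is_point (edge_pt u v (z x)) by exists u, v, (z x); split=> //; right.
pose f x := Realization (zpt x).
have f0 x : x <= 0 -> f x = q.
  by move=> x0; apply: coord_inj; rewrite qE /= /z max_r // min_l // mulr0 addr0.
have fa x : a <= x -> f x = r.
  move=> ax; apply: coord_inj; rewrite rE /= /z max_l ?(le_trans a0) // min_r //.
  by rewrite /a distrC -numEsg addrC subrK.
have flip x y : x <= y -> rdist (f x) (f y) <= y - x.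
  move=> xy; have := rdist_edge (p := f x) (q := f y) uv (hz x) (hz y) erefl erefl.
  move=> h; apply: le_trans h _.
  rewrite /z opprD addrACA subrr add0r -mulrBr normrM.
  have /andP[m1 m2] := clamp_lipschitz a xy.
  rewrite distrC (ger0_norm m1); apply: le_trans m2.
  by rewrite ler_piMl // normr_sg; case: (_ != _); rewrite ?lexx ?ler01.
exists (fun x => if x <= l then c x else f (x - l)); have l0 := chain_ge0 pql.
split=> [x x0|x lx|x y xy].
- by rewrite (le_trans x0 l0) c0.
- case: (lerP x l) => xl; last by apply: fa; rewrite /a; lra.
  have aE : a = 0 by rewrite /a in a0 *; lra.
  by rewrite cl; [rewrite -(f0 0) // -(fa 0) // aE | rewrite /a in aE; lra].
case: (lerP x l) => xl; case: (lerP y l) => yl.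
- exact: clip.
- apply: le_trans (rdist_triangle q _ _) _.
  have := clip x l xl; rewrite (cl l) // => h1.
  have : 0 <= y - l by rewrite subr_ge0 ltW.
  by move/(flip 0); rewrite f0 // => h2; lra.
- by exfalso; lra.
- by have := flip (x - l) (y - l); rewrite lerB // => /(_ isT); lra.
Qed.

(** A 1-Lipschitz curve whose length is the distance between its ends cannot be
    shorter anywhere, hence is isometric. *)
Lemma geodesic_segment_exists p q : exists A, geodesic_segment p q A.
Proof.
have [c [c0 cl clip]] := chain_curve (chain_rdist p q).
exists (c @` `[0, rdist p q]), c; split=> //; first by exact: c0.
  exact: cl.
have d0 x y : x <= y -> x \in `[0, rdist p q] -> y \in `[0, rdist p q] ->
    rdist (c x) (c y) = y - x.
  rewrite !in_itv /= => xy /andP[x0 _] /andP[_ yl].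
  apply/eqP; rewrite eq_le clip //=.
  have h1 := clip _ _ x0; have h2 := clip _ _ yl.
  rewrite (c0 0) // in h1; rewrite (cl (rdist p q)) // in h2.
  have h3 := rdist_triangle (c x) p q; have h4 := rdist_triangle (c y) (c x) q.
  by lra.
move=> x y hx hy; change (rdist (c x) (c y) = `|x - y|).
have [xy|/ltW yx] := leP x y; first by rewrite d0 // distrC ger0_norm // subr_ge0.
by rewrite rdist_sym d0 // ger0_norm // subr_ge0.
Qed.

End Realization.

(** * Maps induced on geometric realizations *)

Section InducedMaps.
Variable R : realType.
Implicit Types (A B C : graph).

Lemma rmap_vertex A B (f : graph_embedding A B) u :
  rmap f (rvertex R u) = rvertex R (f u).
Proof. by apply: coord_inj; rewrite /= push_edge_pt. Qed.

Lemma chain_rmap A B (f : graph_embedding A B) (p q : realization R A) l :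
  chain p q l -> chain (rmap f p) (rmap f q) l.
Proof.
elim=> [|u v s t {}q r {}l uv hs ht qE rE _ IH]; first exact: chain_nil.
apply: (chain_rcons (emb_adj f uv) hs ht _ _ IH).
  by rewrite /= qE push_edge_pt.
by rewrite /= rE push_edge_pt.
Qed.

Lemma rdist_rmap_le A B (f : graph_embedding A B) (p q : realization R A) :
  rdist (rmap f p) (rmap f q) <= rdist p q.
Proof. by apply: rdist_lb => l /(chain_rmap f); exact: rdist_le. Qed.

Lemma rmap_id A (f : graph_embedding A A) (p : realization R A) :
  (forall u, f u = u) -> rmap f p = p.
Proof.
move=> f1; apply: coord_inj => /=; have [u [v [t [_ _ ->]]]] := coordP p.
by rewrite push_edge_pt !f1.
Qed.

Lemma rmap_comp A B C (f : graph_embedding A B) (g : graph_embedding B C)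
    (h : graph_embedding A C) (p : realization R A) :
  (forall u, h u = g (f u)) -> rmap h p = rmap g (rmap f p).
Proof.
move=> hE; apply: coord_inj => /=; have [u [v [t [_ _ ->]]]] := coordP p.
by rewrite !push_edge_pt !hE.
Qed.

Lemma isometric_action_rmap (G : groupType) (Y : graph) (rho : graph_action G Y) :
  isometric_action (fun g => rmap (rho g) : realization R Y -> realization R Y).
Proof.
have act1 p : rmap (rho 1%g) p = p :> realization R Y by apply: rmap_id; exact: gact1.
have actM g h p : rmap (rho (g * h)%g) p = rmap (rho g) (rmap (rho h) p)
    :> realization R Y by apply: rmap_comp => u; exact: gactM.
split=> // g p q; apply/eqP; rewrite eq_le; apply/andP; split.
  exact: rdist_rmap_le.
rewrite -{1}(act1 p) -{1}(act1 q) -(mulVg g) !actM; exact: rdist_rmap_le.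
Qed.

End InducedMaps.

(** * Geodesic segments *)

Section GeodesicSegments.
Variables (R : realType) (X : metricType R).
Implicit Types (x y z : X) (A : set X).

Lemma geodesic_segment_dist x y z A : geodesic_segment x y A -> A z ->
  mdist x z + mdist z y = mdist x y.
Proof.
move=> [c [c0 cl iso ->]] [t /= t_in <-]; move: (t_in); rewrite in_itv /= => /andP[t0 tl].
have z_in : 0 \in `[0, mdist x y] by rewrite in_itv /= lexx mdist_ge0.
have l_in : mdist x y \in `[0, mdist x y] by rewrite in_itv /= lexx mdist_ge0.
have -> : mdist x (c t) = t by rewrite -{1}c0 iso // sub0r normrN ger0_norm.
rewrite -{1}cl iso // distrC ger0_norm ?subr_ge0 //; lra.
Qed.

(** Points at distance at most one along a geodesic replace the continuous curve
    by a finite path. *)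
Lemma geodesic_segment_sample x y A : geodesic_segment x y A ->
  exists k (c : nat -> X), [/\ c 0%N = x, c k.+1 = y,
    forall i, A (c i) & forall i, mdist (c i) (c i.+1) <= 1].
Proof.
move=> [c [c0 cl iso ->]]; set l := mdist x y in cl iso *.
have l0 : 0 <= l by exact: mdist_ge0.
pose t (i : nat) : R := Num.min i%:R l.
have t_in i : t i \in `[0, l] by rewrite in_itv /= ge_min lexx orbT le_min ler0n l0.
exists (Num.truncn l), (c \o t); split=> [||i|i] /=.
- by rewrite /t min_l.
- by rewrite /t min_r // ltW // truncnS_gt.
- by exists (t i); [exact: t_in |].
rewrite iso // distrC /t -natr1.
have i0 : 0 <= i%:R :> R by [].
by case: (lerP (i%:R + 1) l) => h1; case: (lerP i%:R l) => h2; rewrite ger0_norm; lra.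
Qed.

End GeodesicSegments.

(** * Geodesics of the graph of pieces *)

Section CoarseGeometry.
Variables (R : realType) (T : choiceType) (L : seq (T * bool) -> Prop).
Hypothesis Llang : piece_language L.
Variables (e : rel (freeGroup T)) (e_sym : symmetric e) (e_irr : irreflexive e).
Hypothesis e_conn : forall x y, exists2 p, path e x p & last x p = y.
Hypothesis eP : forall x y, e x y <-> x <> y /\ L (fword (x^-1 * y)%g).

Let Y : graph := Graph e_sym e_irr e_conn.
Local Notation vtx x := (rvertex R (x : Y)).
Implicit Types (x y m : freeGroup T) (p q r : realization R Y).

(** Replacing the three points by vertices at distance at most one costs 2 in each
    of three distances, which [near_between] turns into 4 for the distance to the
    tree, and one more for [r] itself. *)
Lemma near_tree_geodesic p q r x y : rdist p r + rdist r q = rdist p q ->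
  rdist p (vtx x) <= 1 -> rdist q (vtx y) <= 1 ->
  exists2 m, between x m y & rdist r (vtx m) <= 5.
Proof.
move=> prq px qy; have [z rz] := near_vertex r.
have h1 := rdist_triangle p (vtx x) (vtx z); have h2 := rdist_triangle r p (vtx z).
have h3 := rdist_triangle q (vtx z) (vtx y); have h4 := rdist_triangle r (vtx z) q.
have h5 := rdist_triangle (vtx x) p q; have h6 := rdist_triangle (vtx y) (vtx x) q.
rewrite (rdist_sym (vtx x) p) in h1; rewrite (rdist_sym (vtx z) r) in h4.
rewrite (rdist_sym (vtx y) q) in h6.
have : rdist (vtx x) (vtx z) + rdist (vtx z) (vtx y) <= rdist (vtx x) (vtx y) + 6%:R.
  by lra.
rewrite !rdist_vertex -!natrD ler_nat => /(near_between Llang eP)[m xmy zm].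
exists m => //; have : rdist (vtx z) (vtx m) <= 4.
  by rewrite rdist_vertex ler_nat -leq_double; exact: zm.
by have := rdist_triangle (vtx z) r (vtx m); lra.
Qed.

(** Rounding points at unit distance along the geodesic gives a path of vertices
    with jumps of size at most 3, to which [between_near_path] applies. *)
Lemma near_geodesic p q A x y m : geodesic_segment p q A ->
  rdist p (vtx x) <= 1 -> rdist q (vtx y) <= 1 -> between x m y ->
  exists2 r, A r & rdist (vtx m) r <= 4.
Proof.
move=> /geodesic_segment_sample[k [c [c0 ck Ac c1]]] px qy xmy.
have [v vE] := choice (fun i => near_vertex (c i)).
pose v' i := if i == 0%N then x else if i == k.+1 then y else v i.
have v'E i : rdist (c i) (vtx (v' i)) <= 1.
  rewrite /v'; case: eqP => [->|_]; first by rewrite c0.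
  by case: eqP => [->|_] //; rewrite ck.
have v'1 i : (i < k.+1)%N -> (gdist (v' i : Y) (v' i.+1) <= 3)%N.
  move=> _; rewrite -(ler_nat R) -rdist_vertex.
  have h1 := rdist_triangle (c i) (vtx (v' i)) (vtx (v' i.+1)).
  have h2 := rdist_triangle (c i.+1) (c i) (vtx (v' i.+1)).
  have := v'E i; have := v'E i.+1; have := c1 i.
  rewrite (rdist_sym (vtx (v' i)) (c i)) in h1.
  by rewrite -[mdist _ _]/(rdist _ _); lra.
have [|i _ mi] := between_near_path Llang eP (m := m) v'1.
  by rewrite /v' /= eqxx.
exists (c i) => //; have := rdist_triangle (vtx (v' i)) (vtx m) (c i).
have := v'E i; rewrite (rdist_sym (c i)) => h1.
have : rdist (vtx m) (vtx (v' i)) <= 3 by rewrite rdist_vertex ler_nat.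
by lra.
Qed.

(** Triangles are slim because they are close to tree triangles, which are
    tripods. *)
Lemma piece_graph_hyperbolic : gromov_hyperbolic (realization R Y).
Proof.
split; first exact: geodesic_segment_exists.
exists 9; first by rewrite ler0n.
move=> x y z A B C gA gB gC a Aa.
have [x' xx'] := near_vertex x; have [y' yy'] := near_vertex y.
have [z' zz'] := near_vertex z.
have [m b am] := near_tree_geodesic (geodesic_segment_dist gA Aa) xx' yy'.
suff [r BCr mr] : exists2 r, (B `|` C) r & rdist (vtx m) r <= 4.
  exists r => //; apply: le_trans (rdist_triangle (vtx m) _ _) _; lra.
case: (between_triangle z' b) => [bxz|/between_sym byz].
  by have [r Cr mr] := near_geodesic gC xx' zz' bxz; exists r => //; right.
by have [r Br mr] := near_geodesic gB yy' zz' byz; exists r => //; left.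
Qed.

End CoarseGeometry.

(** * Acylindricity *)

(** Numbers whose gaps are all at least a [K]-th of their range are at most [K + 1]
    in number: divide the range into [K] parts. *)
Lemma sparse_card (A : Type) (S : set A) (s : A -> nat) (N K : nat) :
  (forall g h, S g -> S h -> s g = s h -> g = h) ->
  (forall g, S g -> (s g <= N)%N) ->
  (forall g h g1 h1, S g -> S h -> S g1 -> S h1 -> (s g1 < s h1)%N ->
     (s h - s g <= K * (s h1 - s g1))%N) ->
  (S #<= `I_K.+1)%card.
Proof.
move=> s_inj sN gap; have [->|/set0P[g0 Sg0]] := eqVneq S set0; first exact: card_ge0.
pose P n := `[< exists2 g, S g & s g = n >].
have exP : exists n, P n by exists (s g0); apply/asboolP; exists g0.
have PN n : P n -> (n <= N)%N by case/asboolP => g Sg <-; exact: sN.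
have PS g : S g -> P (s g) by move=> Sg; apply/asboolP; exists g.
case: (ex_minnP exP) => a /asboolP[gmin Smin aE] a_min.
case: (ex_maxnP exP PN) => b /asboolP[gmax Smax bE] b_max.
pose f g := (K * (s g - a) %/ (b - a))%N.
have bounds g : S g -> (a <= s g <= b)%N.
  by move=> /PS Pg; rewrite a_min ?b_max.
have f_bound g : S g -> (f g <= K)%N.
  move=> Sg; rewrite /f; have /andP[ag gb] := bounds g Sg.
  have [->|ba0] := posnP (b - a)%N; first by rewrite divn0.
  by rewrite -{2}(mulnK K ba0) leq_div2r // leq_mul2l leq_sub2r // orbT.
have f_lt g h : S g -> S h -> (s g < s h)%N -> (f g < f h)%N.
  move=> Sg Sh gh; have /andP[ag gb] := bounds g Sg; have /andP[ah hb] := bounds h Sh.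
  have ba0 : (0 < b - a)%N by lia.
  have := gap _ _ _ _ Smin Smax Sg Sh gh; rewrite aE bE => gap_ab.
  rewrite /f; have -> : (s h - a = (s h - s g) + (s g - a))%N by lia.
  apply: (@leq_trans ((b - a + K * (s g - a)) %/ (b - a))).
    by rewrite divnDl ?dvdnn // divnn ba0 add1n.
  by rewrite leq_div2r // mulnDr leq_add2r.
have [f_inj {}f_bound] : {in S &, injective f} /\ forall g, S g -> (f g <= K)%N.
  split=> //; move: (f) f_lt => {f f_bound} f f_lt g h /set_mem Sg /set_mem Sh E.
  have [/f_lt-/(_ Sg Sh)|/f_lt-/(_ Sh Sg)|] := ltngtP (s g) (s h).
  - by rewrite E ltnn.
  - by rewrite E ltnn.
  - exact: s_inj.
rewrite -(card_le_eql (inj_card_eq f_inj)); apply: subset_card_le => _ [g Sg <-].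
exact: f_bound.
Qed.

Section Acylindricity.
Variables (T : choiceType) (L : seq (T * bool) -> Prop).
Hypothesis Llang : piece_language L.
Variables (e : rel (freeGroup T)) (e_sym : symmetric e) (e_irr : irreflexive e).
Hypothesis e_conn : forall x y, exists2 p, path e x p & last x p = y.
Hypothesis eP : forall x y, e x y <-> x <> y /\ L (fword (x^-1 * y)%g).
Variable q : nat.
Hypothesis Lper : forall d w, (0 < d)%N -> L w -> has_period d w -> (size w <= q * d)%N.

Local Open Scope nat_scope.

Let Y : graph := Graph e_sym e_irr e_conn.
Local Notation d := (@gdist Y).

Let d_betweenl x m y : between x m y -> d x m <= d x y.
Proof. exact: (between_gdistl Llang e_sym e_irr e_conn eP). Qed.

Let d_betweenr x m y : between x m y -> d m y <= d x y.
Proof. exact: (between_gdistr Llang e_sym e_irr e_conn eP). Qed.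

Let d_betweenD x m y : between x m y -> d x m + d m y <= (d x y).+1.
Proof. exact: (between_gdistD Llang e_sym e_irr e_conn eP). Qed.

Let dMl g x y : d (g * x)%g (g * y)%g = d x y.
Proof. exact: (gdistMl Llang e_sym e_irr e_conn eP). Qed.

Let d_sym x y : d x y = d y x.
Proof. exact: gdist_sym. Qed.

Let d_triangle y x z : d x z <= d x y + d y z.
Proof. exact: gdist_triangle. Qed.

Let d_at x y k : k <= d x y -> exists2 m, between x m y & d x m = k.
Proof. exact: (between_at Llang eP). Qed.

Section Vertices.
Variables (r : nat) (x y m m' : freeGroup T).
Local Open Scope nat_scope.
Hypotheses (xm'y : between x m' y) (xmm' : between x m m').
Hypotheses (xm : r < d x m) (mm' : (r + 1).*2 < d m m') (m'y : r < d m' y).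

Let S : set (freeGroup T) := [set g | d x (g * x)%g <= r /\ d y (g * y)%g <= r].
Let w := fword (x^-1 * y)%g.
Let u := fword (m^-1 * m')%g.
Let pos g := size (fword (x^-1 * (g * m))%g).

Let xmy : between x m y.
Proof. exact: between_trans xmm'. Qed.

(** Away from the ends of the segment, an element that moves the ends little maps
    the tree geodesic from [x] to [y] into itself. *)
Let mulS_between g n : S g -> between x n y -> r < d x n -> r < d n y ->
  between x (g * n)%g y.
Proof.
move=> [gx gy] /(betweenMl g) b xn ny.
case: (between_triangle x b) => [b1|b1].
  have := d_betweenl b1.
  by rewrite dMl leqNgt (leq_ltn_trans _ xn) // d_sym.
case: (between_triangle y b1) => // b2; have := d_betweenr b2.
by rewrite dMl leqNgt (leq_ltn_trans _ ny).
Qed.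

Let xm' : r < d x m'.
Proof. by apply: leq_trans xm (d_betweenl xmm'). Qed.

Let my : r < d m y.
Proof.
by apply: leq_trans m'y _; apply: d_betweenr;
   exact: between_sub xm'y xmm'.
Qed.

Let mulS_m g : S g -> between x (g * m)%g y.
Proof. by move=> Sg; exact: mulS_between. Qed.

Let mulS_m' g : S g -> between x (g * m')%g y.
Proof. by move=> Sg; exact: mulS_between. Qed.

Let mulS_order g : S g -> between x (g * m)%g (g * m')%g.
Proof.
move=> [gx _]; case: (between_triangle x (betweenMl g xmm')) => // b.
have := d_betweenl b.
by rewrite dMl leqNgt (leq_ltn_trans _ xm) // d_sym.
Qed.

Let segM g : fword ((g * m)^-1 * (g * m'))%g = u.
Proof. by rewrite invgM -mulgA mulKg. Qed.

(** Hence [u] is read again along that geodesic, from the image of [m] on. *)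
Let occurrence g : S g -> take (size u) (drop (pos g) w) = u.
Proof.
move=> Sg; rewrite /w (mulS_m' Sg) (mulS_order Sg) segM -catA drop_size_cat //.
by rewrite take_size_cat.
Qed.

(** The image of [m] lies on the same tree geodesic and at nearly the same distance
    from [x]; by [between_gdistD] this leaves little room between the two. *)
Let displacement g : S g -> d m (g * m)%g <= r + 1.
Proof.
move=> Sg; have [gx _] := Sg.
have h1 := d_triangle (g * x)%g x (g * m)%g.
have h2 := d_triangle x (g * x)%g (g * m)%g.
rewrite dMl in h1 h2; rewrite (d_sym (g * x)%g x) in h2.
have [b|b] := between_total xmy (mulS_m Sg); have := d_betweenD b.
  by move: gx h1 h2; lia.
by rewrite (d_sym (g * m)%g m); move: gx h1 h2; lia.
Qed.

Let between_pos g h : S g -> S h -> pos g <= pos h -> between x (g * m)%g (h * m)%g.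
Proof.
move=> Sg Sh gh; have [//|b] := between_total (mulS_m Sg) (mulS_m Sh).
move: gh; rewrite /pos b size_cat -[leqRHS]addn0 leq_add2l leqn0 size_eq0 => /eqP.
move=> /(@fword_inj _ _ 1%g) E.
rewrite (mulgI _ _ _ (etrans E (esym (mulVg _)))); exact: between_r.
Qed.

Let pos_inj g h : S g -> S h -> pos g = pos h -> g = h.
Proof.
move=> Sg Sh E; have := between_pos Sg Sh; rewrite E leqnn => /(_ isT) b.
move: E; rewrite /pos b size_cat => /eqP.
rewrite -[eqbLHS]addn0 eqn_add2l eq_sym size_eq0.
move=> /eqP/(@fword_inj _ _ 1%g) E; apply: (mulIg m).
exact: (mulgI _ _ _ (etrans (mulVg _) (esym E))).
Qed.

(** The stretch of [w] between two occurrences of [u] has few pieces, so it is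
    shorter than [u] and is a prefix of [u]. *)
Let drift g h : S g -> S h -> pos g <= pos h ->
  pieces L (r + 1).*2 (take (pos h - pos g) u) /\ pos h - pos g <= size u.
Proof.
move=> Sg Sh gh; have b := between_pos Sg Sh gh.
have gdm : d (g * m)%g (h * m)%g <= (r + 1).*2.
  apply: leq_trans (d_triangle m _ _) _; rewrite -addnn leq_add //.
    by rewrite d_sym; exact: displacement.
  exact: displacement.
have hE : pos h = pos g + size (fword ((g * m)^-1 * (h * m))%g).
  by rewrite /pos b size_cat.
have hu : pos h - pos g <= size u.
  rewrite leqNgt; apply/negP => uh.
  have b' : between x (g * m')%g (h * m)%g.
    have [//|b'] := between_total (mulS_m' Sg) (mulS_m Sh).
    have := congr1 size b'; rewrite size_cat -/(pos h) (mulS_order Sg) size_cat segM.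
    by rewrite -/(pos g); lia.
  have := d_betweenl (between_sub b' (mulS_order Sg)).
  by rewrite dMl => /leq_trans/(_ gdm); rewrite leqNgt mm'.
split=> //; have := mulS_m Sh; rewrite /between b -/w => wE.
have <- : fword ((g * m)^-1 * (h * m))%g = take (pos h - pos g) u.
  rewrite -(occurrence Sg) take_takel // wE -catA drop_size_cat //.
  by rewrite hE addKn take_size_cat.
exact/(gdist_pieces Llang e_sym e_irr e_conn eP).
Qed.

(** The lag between two occurrences of [u] is a period of [u], hence of the stretch
    between any two other occurrences.  As that stretch has few pieces, and pieces
    are short compared with their periods, it is short compared with the lag. *)
Lemma lag_lower_bound g h g1 h1 : S g -> S h -> S g1 -> S h1 -> pos g1 < pos h1 ->
  pos h - pos g <= q * (r + 1).*2 * (pos h1 - pos g1).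
Proof.
move=> Sg Sh Sg1 Sh1 gh1; have [gh|/ltnW] := leqP (pos g) (pos h); last first.
  by rewrite -subn_eq0 => /eqP->.
have [dp du] := drift Sg Sh gh.
have per := has_period_occurrences (ltnW gh1) (occurrence Sg1) (occurrence Sh1).
have lag0 : 0 < pos h1 - pos g1 by rewrite subn_gt0.
rewrite mulnAC -{1}(size_takel du).
apply: (pieces_period_size _ dp); first by move=> v; exact: Lper.
apply: (has_period_factor (u := [::]) (w := drop (pos h - pos g) u)).
by rewrite cat0s cat_take_drop.
Qed.

Lemma card_small_displacement : (S #<= `I_(q * (r + 1).*2).+1)%card.
Proof.
apply: (@sparse_card _ S pos (size w)) => [|g Sg|]; first exact: pos_inj.
  by rewrite /w (mulS_m Sg) size_cat leq_addr.
exact: lag_lower_bound.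
Qed.

End Vertices.

(** Two vertices on the tree geodesic from [x] to [y], far from each other and from
    both ends, span the word whose recurrences are counted. *)
Lemma card_small_displacement_far r x y : 4 * r + 6 <= d x y ->
  ([set g | d x (g * x)%g <= r /\ d y (g * y)%g <= r] #<= `I_(q * (r + 1).*2).+1)%card.
Proof.
move=> far.
(* The distances from [x] leave [r + 1] before [m] and after [m'], and [2 r + 4]
   between them. *)
have [|m' xm'y xm'] := @d_at x y (3 * r + 5); first by lia.
have [|m xmm' xm] := @d_at x m' (r + 1); first by rewrite xm'; lia.
have h1 := d_triangle m x m'; have h2 := d_triangle m' x y.
apply: (card_small_displacement xm'y xmm'); first by rewrite xm addn1.
- by rewrite -ltnS -doubleS -addnn; move: h1; rewrite xm xm'; lia.
- by move: h2 far; rewrite xm'; lia.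
Qed.

Section Realization.
Variables (R : realType) (rho : graph_action (freeGroup T) Y).
Hypothesis rhoE : forall g v, rho g v = (g * v)%g.

Lemma piece_graph_acylindrical :
  acylindrical (fun g => rmap (rho g) : realization R Y -> realization R Y).
Proof.
move=> r0 r0_ge0.
(* Vertices near the two points move at most [r0 + 2]. *)
pose r := (Num.truncn r0 + 3)%N.
have r0r : (r0 + 2 <= r%:R)%R.
  by have := truncnS_gt r0; rewrite /r -natr1 natrD; lra.
exists (4 * r + 8)%:R%R, (q * (r + 1).*2).+1; split=> //; first by rewrite ler1n; lia.
move=> p p' far; have [x px] := near_vertex p; have [y py] := near_vertex p'.
have far' : 4 * r + 8 <= d x y + 2.
  rewrite -(ler_nat R) [leRHS]natrD -(rdist_vertex R (Y := Y)).
  have h1 := rdist_triangle (rvertex R (x : Y)) p p'.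
  have h2 := rdist_triangle (rvertex R (y : Y)) (rvertex R (x : Y)) p'.
  rewrite (rdist_sym (rvertex R (y : Y)) p') in h2.
  by apply: le_trans far _; rewrite -[mdist _ _]/(rdist _ _); lra.
have {}far' : 4 * r + 6 <= d x y by lia.
apply: card_le_trans (card_small_displacement_far far').
have near_le (s : realization R Y) z g : (rdist s (rvertex R (z : Y)) <= 1)%R ->
    (rdist s (rmap (rho g) s) <= r0)%R -> d z (g * z)%g <= r.
  move=> sz sg; rewrite -(ler_nat R) -(rdist_vertex R (Y := Y)) -rhoE -rmap_vertex.
  have h1 := rdist_triangle s (rvertex R (z : Y)) (rmap (rho g) (rvertex R (z : Y))).
  have h2 := rdist_triangle (rmap (rho g) s) s (rmap (rho g) (rvertex R (z : Y))).
  have h3 := rdist_rmap_le (rho g) s (rvertex R (z : Y)).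
  by rewrite (rdist_sym (rvertex R (z : Y)) s) in h1; lra.
by apply: subset_card_le => g [gp gp'];
   split; [exact: near_le px gp | exact: near_le py gp'].
Qed.

End Realization.
End Acylindricity.

(** * Powers in a free group *)

Section Powers.
Variable T : choiceType.
Implicit Types (w : seq (T * bool)) (c g h : freeGroup T).
Local Open Scope nat_scope.

Lemma linv_neq (x : T * bool) : x != linv x.
Proof. by case: x => t b; rewrite xpair_eqE eqxx; case: b. Qed.

Lemma conjg_expn h c n : ((h * c * h^-1) ^+ n = h * c ^+ n * h^-1)%g.
Proof.
elim: n => [|n IH]; first by rewrite !expg0 mulg1 mulgV.
by rewrite !expgS IH -!mulgA mulKg.
Qed.

(** If the word is not cyclically reduced, its first and last letters are inverse
    to each other and conjugation removes both. *)
Lemma cyclic_reduction g : g != 1%g ->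
  exists h c, [/\ g = (h * c * h^-1)%g, fword c != [::] & reduced (fword c ++ fword c)].
Proof.
have [n] := ubnP (size (fword g)); elim: n g => // n IH g gn g1.
have [rgg|nrgg] := boolP (reduced (fword g ++ fword g)).
  by exists 1%g, g; rewrite invg1 mulg1 mul1g.
have rg := reduced_fword g; case gE : (fword g) rg nrgg gn => [|x v] //.
case/lastP: v gE => [|v y] gE; first by rewrite /reduced /= andbT linv_neq.
move=> rg; rewrite /reduced /= cat_path last_rcons /= (rg : path _ _ _) andbT negbK.
move=> /eqP xy; have {xy} yE : y = linv x by rewrite xy linvK.
rewrite yE -cats1 in gE rg *; have [rxv _] := reduced_cat (s := x :: v) rg.
have [_ rv] := reduced_cat (s := [:: x]) rxv.
pose X : freeGroup T := @FreeGroup _ [:: x] isT; pose V : freeGroup T := FreeGroup rv.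
have gXV : g = (X * V * X^-1)%g.
  apply: fword_inj; rewrite gE !fwordM fwordV [fmulw (fword X) _]lpush_cons //.
  exact/esym/(@fmulw_cat _ (x :: v)).
rewrite /= size_cat addn1 => vn; have [||h [c [VE c0 rcc]]] := IH V.
- exact: ltnW.
- by apply/eqP => V1; case/eqP: g1; rewrite gXV V1 mulg1 mulgV.
exists (X * h)%g, c; split=> //.
by rewrite gXV VE invgM !mulgA.
Qed.

Lemma reduced_power w n : w != [::] -> reduced (w ++ w) -> reduced (flatten (nseq n w)).
Proof.
case: w => // x v _; elim: n => // -[|n] IH rww.
  by have [] := reduced_cat rww; rewrite /= cats0.
have := IH rww; move: rww; rewrite /reduced /= !cat_path /= !cat_path.
by move=> /and3P[-> -> _].
Qed.

Lemma fword_expg c n : fword c != [::] -> reduced (fword c ++ fword c) ->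
  fword (c ^+ n)%g = flatten (nseq n (fword c)).
Proof.
move=> c0 rcc; elim: n => [|n IH]; first by rewrite expg0.
by rewrite expgS fwordM IH fmulw_cat //; exact: (reduced_power n.+1).
Qed.

Lemma flatten_nseqSr w n : flatten (nseq n.+1 w) = flatten (nseq n w) ++ w.
Proof. by elim: n => [|n IH] /=; [rewrite cats0 | rewrite -catA -IH]. Qed.

Lemma has_period_power w n : has_period (size w) (flatten (nseq n w)).
Proof.
case: n => [|n] x0 i; first by rewrite ltn0.
rewrite {1 2}flatten_nseqSr size_cat ltn_add2r => iw.
by rewrite nth_cat iw /= nth_cat ltnNge leq_addl /= addnK.
Qed.

Lemma size_power w n : size (flatten (nseq n w)) = n * size w.
Proof. by elim: n => //= n IH; rewrite size_cat IH mulSn. Qed.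

End Powers.

(** * Translation lengths *)

(** Fekete's lemma: the limit is the infimum of the sequence from 1 on. *)
Lemma subadditive_cvg (R : realType) (u : R ^nat) : (forall n, 0 <= u n) ->
  (forall m n, u (m + n)%N <= u m + u n) -> cvgn (fun n => u n / n%:R).
Proof.
move=> u0 uD; pose A := [set u n.+1 / n.+1%:R | n in [set: nat]].
have A0 : A !=set0 by exists (u 1%N / 1%:R), 0%N.
have Alb : has_lbound A.
  by exists 0 => _ [n _ <-]; rewrite divr_ge0.
have uM k m : u (k * m)%N <= k%:R * u m + u 0%N.
  elim: k => [|k IH]; first by rewrite mul0n mul0r add0r.
  by rewrite mulSn -add1n natrD mulrDl mul1r -addrA; apply: le_trans (uD _ _) _; rewrite lerD2l.
apply/cvg_ex; exists (inf A); apply/cvgrPdist_le => /= eps eps0.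
have eps2 : 0 < eps / 2 by rewrite divr_gt0.
have [_ [m _ <-] um] := inf_adherent eps2 (conj A0 Alb).
pose B := u 0%N + m.+1%:R * u 1%N + u 0%N.
near=> n.
have n0 : (0 : R) < n%:R.
  by rewrite ltr0n; near: n; exact: nbhs_infty_gt.
have low : inf A <= u n / n%:R.
  apply: ge_inf => //; exists n.-1 => //; rewrite prednK //.
  by rewrite -(ltr0n R).
rewrite distrC ger0_norm ?subr_ge0 // lerBlDl.
have unB : u n <= (n %/ m.+1)%:R * u m.+1 + B.
  rewrite {1}(divn_eq n m.+1) /B; have h1 := uD (n %/ m.+1 * m.+1)%N (n %% m.+1)%N.
  have h2 := uM (n %/ m.+1)%N m.+1; have := uM (n %% m.+1)%N 1%N.
  rewrite muln1 => h3.
  have : (n %% m.+1)%:R * u 1%N <= m.+1%:R * u 1%N.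
    by rewrite ler_wpM2r // ler_nat ltnW // ltn_mod.
  by lra.
have unm : (n %/ m.+1)%:R * u m.+1 <= n%:R * (u m.+1 / m.+1%:R).
  by rewrite mulrA ler_pdivlMr ?ltr0n // mulrAC ler_wpM2r // -natrM ler_nat leq_divM.
have unm' : n%:R * (u m.+1 / m.+1%:R) <= n%:R * (inf A + eps / 2).
  by rewrite ler_pM2l // ltW.
have Bn : B <= n%:R * (eps / 2).
  by rewrite -ler_pdivrMr //; near: n; exact: nbhs_infty_ger.
rewrite ler_pdivrMr // [leRHS]mulrC; apply: le_trans unB _.
by apply: le_trans (lerD (le_trans unm unm') Bn) _; rewrite -mulrDr -addrA -splitr.
Unshelve. all: by end_near.
Qed.

Section IsometricActions.
Variables (R : realType) (G : groupType) (X : metricType R) (act : G -> X -> X).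
Hypothesis iso : isometric_action act.
Implicit Types (x : X) (g : G).

Let displ x g n := mdist x (act (g ^+ n)%g x).

Lemma displacementD x g m n : displ x g (m + n) <= displ x g m + displ x g n.
Proof.
have [_ actM actI] := iso; rewrite /displ expgnDr actM.
by apply: le_trans (metric_triangle _ (act (g ^+ m)%g x) _) _; rewrite actI.
Qed.

(** The limit has to be shown to exist, since the limit of a divergent sequence is
    a default value. *)
Lemma translation_length_ge x g (a b C : R) : b < a ->
  (forall n, n%:R * a - C <= displ x g n) -> b <= translation_length act x g.
Proof.
move=> ba lin; apply: limr_ge.
  apply: (@subadditive_cvg _ (displ x g)) => [n|m n]; first exact: mdist_ge0.
  exact: displacementD.
have ab0 : 0 < a - b by rewrite subr_gt0.
near=> n.
have n0 : (0 : R) < n%:R by rewrite ltr0n; near: n; exact: nbhs_infty_gt.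
have Cn : C <= n%:R * (a - b).
  by rewrite -ler_pdivrMr //; near: n; exact: nbhs_infty_ger.
rewrite ler_pdivlMr //; apply: le_trans (lin n); lra.
Unshelve. all: by end_near.
Qed.

Lemma zpowS g (m : int) : zpow g (m + 1) = (zpow g m * g)%g.
Proof.
case: m => [n|[|n]]; first by rewrite -PoszD addn1 /zpow expgSr.
  by have -> : Negz 0 + 1 = 0%N by []; rewrite /zpow expg0 expg1 mulVg.
have -> : Negz n.+1 + 1 = Negz n by rewrite !NegzE; lia.
by rewrite /zpow [X in (X^-1 * _)%g]expgS invgM -mulgA mulVg mulg1.
Qed.

Lemma zpowD g (m : int) (n : nat) : zpow g (m + n%:Z) = (zpow g m * g ^+ n)%g.
Proof.
elim: n => [|n IH]; first by rewrite addr0 expg0 mulg1.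
by rewrite -addn1 PoszD addrA zpowS IH addn1 expgSr mulgA.
Qed.

Lemma mdist_zpow x g (m n : int) :
  mdist (act (zpow g m) x) (act (zpow g n) x) = displ x g `|m - n|%N.
Proof.
have [_ actM actI] := iso; wlog mn : m n / m <= n.
  move=> W; have [/W //|/ltW/W] := leP m n.
  by rewrite metric_sym distnC.
have -> : n = m + `|m - n|%N%:Z by lia.
by rewrite zpowD actM actI; congr displ; lia.
Qed.

(** Linear growth of the displacements of the positive powers is enough: the orbit
    map of a cyclic group is always Lipschitz. *)
Lemma loxodromic_linear g : 
  (forall x, exists a C : R, 0 < a /\ forall n, n%:R * a - C <= displ x g n) ->
  loxodromic act g.
Proof.
move=> lin x; have [a [C [a0 aC]]] := lin x.
have D0 : 0 <= displ x g 1 by exact: mdist_ge0.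
have ai0 : 0 < a^-1 by rewrite invr_gt0.
have upper n : displ x g n <= n%:R * displ x g 1.
  elim: n => [|n IH].
    by have [act1 _ _] := iso; rewrite mul0r /displ expg0 act1 mdistxx.
  by rewrite -addn1 natrD mulrDl mul1r; apply: le_trans (displacementD _ _ _ _) _; rewrite lerD2r.
exists (1 + a^-1 + displ x g 1), `|C|; split=> [||m n]; [lra|exact: normr_ge0|].
rewrite mdist_zpow.
have -> : `|m - n|%:~R = `|m - n|%N%:R :> R by rewrite -abszE.
move: `|m - n|%N => k; have k0 : (0 : R) <= k%:R by [].
have kD : 0 <= k%:R * (1 + a^-1) by rewrite mulr_ge0 //; lra.
apply/andP; split; last first.
  by apply: le_trans (upper k) _; have := normr_ge0 C; rewrite mulrDl [_ * k%:R]mulrC; lra.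
have : (1 + a^-1 + displ x g 1)^-1 * k%:R <= k%:R * a.
  rewrite mulrC ler_wpM2l // -[leRHS]invrK lef_pV2 ?posrE //; lra.
have := aC k; have := ler_norm C; lra.
Qed.

End IsometricActions.

(** * Powers in the graph of pieces *)

Section PowersPieceGraph.
Variables (T : choiceType) (L : seq (T * bool) -> Prop).
Hypothesis Llang : piece_language L.
Variables (e : rel (freeGroup T)) (e_sym : symmetric e) (e_irr : irreflexive e).
Hypothesis e_conn : forall x y, exists2 p, path e x p & last x p = y.
Hypothesis eP : forall x y, e x y <-> x <> y /\ L (fword (x^-1 * y)%g).
Variable q : nat.
Hypothesis Lper : forall d w, (0 < d)%N -> L w -> has_period d w -> (size w <= q * d)%N.

Let Y : graph := Graph e_sym e_irr e_conn.

(** The power of a cyclically reduced word is periodic, so that its pieces cannot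
    be long compared with the period. *)
Lemma gdist_power g : g != 1%g ->
  exists h : freeGroup T, forall n, (n <= q * gdist (h : Y) (g ^+ n * h)%g)%N.
Proof.
move=> /cyclic_reduction[h [c [-> c0 rcc]]]; exists h => n.
have E : (h^-1 * ((h * c * h^-1) ^+ n * h) = c ^+ n)%g.
  by rewrite conjg_expn -!mulgA mulKg mulVg mulg1.
have := gdist_piecesP Llang e_sym e_irr e_conn eP h ((h * c * h^-1) ^+ n * h)%g.
rewrite E fword_expg // -/Y => pc.
have s0 : (0 < size (fword c))%N by rewrite lt0n size_eq0.
have := pieces_period_size (fun v => @Lper _ v s0) pc (@has_period_power _ _ _).
by rewrite size_power mulnAC leq_pmul2r.
Qed.

Variables (R : realType) (rho : graph_action (freeGroup T) Y).
Hypothesis rhoE : forall g v, rho g v = (g * v)%g.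
Hypothesis q0 : (0 < q)%N.

Lemma rdist_power g (p : realization R Y) : g != 1%g ->
  exists C : R, forall n, n%:R * q%:R^-1 - C <= rdist p (rmap (rho (g ^+ n)%g) p).
Proof.
move=> /gdist_power[h hn]; pose v := rvertex R (h : Y).
exists (rdist p v + rdist p v) => n; have := hn n.
rewrite -(ler_nat R) natrM -(rdist_vertex R (Y := Y)) -rhoE -rmap_vertex.
rewrite -ler_pdivrMl ?ltr0n // mulrC => h0; rewrite lerBlDr; apply: le_trans h0 _.
have h1 := rdist_triangle p v (rmap (rho (g ^+ n)%g) v).
have h2 := rdist_triangle (rmap (rho (g ^+ n)%g) p) p (rmap (rho (g ^+ n)%g) v).
have h3 := rdist_rmap_le (rho (g ^+ n)%g) p v.
by rewrite (rdist_sym v p) in h1; rewrite -/v; lra.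
Qed.

End PowersPieceGraph.

(** * The action *)

Section PeriodDoublingGraph.
Implicit Types (x y : freeGroup bool).

Lemma letter_piece_language (T : choiceType) :
  piece_language (fun w : seq (T * bool) => (size w <= 1)%N).
Proof.
split=> // [u v w|w]; last by rewrite size_finvw.
by rewrite !size_cat; lia.
Qed.

Lemma F2_basis_fgen (t : bool) : F2_basis (fgen t).
Proof. by case: t; [left | right]. Qed.

Lemma cayley_adjP x y : cayley_adj F2_basis x y <->
  x <> y /\ (size (fword (x^-1 * y)%g) <= 1)%N.
Proof.
have fgenP (u v s : F2) : F2_basis s -> v = (u * s)%g ->
    (size (fword (u^-1 * v)%g) <= 1)%N.
  by move=> Ss ->; rewrite mulKg; case: Ss => ->.
split=> [xy|[xy]].
  split; first by move=> E; move: xy; rewrite E cayley_adj_irrefl.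
  move/asboolP: xy => [s Ss [E|E]]; first exact: fgenP Ss E.
  by rewrite fwordVM size_finvw; exact: fgenP Ss E.
case E : (fword (x^-1 * y)%g) => [|[t b] []] // _.
  by case: xy; apply: (mulgI x^-1%g); rewrite mulVg; apply/esym/fword_inj.
apply/asboolP; exists (fgen t); first exact: F2_basis_fgen.
case: b E => E; [left | right].
  apply: (mulgI x^-1%g); rewrite mulKg; exact: fword_inj.
apply: (mulgI y^-1%g); rewrite mulKg; apply: fword_inj.
by rewrite fwordVM E.
Qed.

Definition pd_adj : rel (freeGroup bool) :=
  fun x y => (x != y) && `[< pd_lang (fword (x^-1 * y)%g) >].

Lemma pd_adjP x y : pd_adj x y <-> x <> y /\ pd_lang (fword (x^-1 * y)%g).
Proof.
split=> [/andP[/eqP xy /asboolP xyL] //|[xy xyL]].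
by apply/andP; split; [apply/eqP | apply/asboolP].
Qed.

Lemma pd_adj_sym : symmetric pd_adj.
Proof.
suff sub x y : pd_adj x y -> pd_adj y x by move=> x y; apply/idP/idP; exact: sub.
move=> /pd_adjP[xy xyL]; apply/pd_adjP; split; first exact: nesym.
by rewrite fwordVM; apply: (lang_inv pd_piece_language).
Qed.

Lemma pd_adj_irrefl : irreflexive pd_adj.
Proof. by move=> x; rewrite /pd_adj eqxx. Qed.

Lemma cayley_pd_adj x y : cayley_adj F2_basis x y -> pd_adj x y.
Proof.
move=> /cayley_adjP[xy]; case E : (fword (x^-1 * y)%g) => [|l []] // _.
  by case: xy; apply: (mulgI x^-1%g); rewrite mulVg; apply/esym/fword_inj.
by apply/pd_adjP; split=> //; rewrite E; exact: (lang_letter pd_piece_language).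
Qed.

Lemma pd_adj_connected x y : exists2 p, path pd_adj x p & last x p = y.
Proof.
have [p xp py] := cayley_connected x y; exists p => //.
by apply: sub_path xp => u v; exact: cayley_pd_adj.
Qed.

Definition pd_graph : graph := Graph pd_adj_sym pd_adj_irrefl pd_adj_connected.

Lemma pd_adjMl (g : F2) (x y : pd_graph) : adj x y -> adj ((g * x)%g : pd_graph) (g * y)%g.
Proof.
move=> /pd_adjP[xy xyL]; apply/pd_adjP; split; first by move/mulgI.
by rewrite invgM -mulgA mulKg.
Qed.

Definition pd_translation (g : F2) : graph_embedding pd_graph pd_graph :=
  @GraphEmbedding pd_graph pd_graph (fun x => (g * x)%g) (@mulgI _ g) (@pd_adjMl g).

Definition pd_action : graph_action F2 pd_graph :=
  @GraphAction F2 pd_graph pd_translation (@mul1g F2) (fun g h x => esym (mulgA g h x)).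

Definition pd_inclusion : graph_embedding cayley_F2 pd_graph :=
  @GraphEmbedding cayley_F2 pd_graph id (@inj_id _) cayley_pd_adj.

End PeriodDoublingGraph.

(** * Orbits *)

Section WordNorm.
Variable R : realType.
Implicit Types g h : F2.

Lemma size_fwordM g h : (size (fword (g * h)%g) <= size (fword g) + size (fword h))%N.
Proof.
have [a [b [c [gE hE ghE]]]] := fmulw_cancel (reduced_fword g) (reduced_fword h).
by rewrite fwordM ghE gE hE !size_cat size_finvw; lia.
Qed.

Lemma word_exists g : exists s : seq F2,
  {in s, forall x, F2_basis x \/ F2_basis x^-1%g} /\ (\prod_(x <- s) x)%g = g.
Proof.
have [n] := ubnP (size (fword g)); elim: n g => // n IH g.
case gE : (fword g) => [|[t b] v] gn.
  by exists [::]; split=> //; rewrite big_nil; apply/esym/fword_inj.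
have rg := reduced_fword g; rewrite gE in rg.
have [_ rv] := reduced_cat (s := [:: (t, b)]) rg.
have [s [sS sE]] := IH (FreeGroup rv : F2) gn.
exists ((@FreeGroup _ [:: (t, b)] isT : F2) :: s); split.
  move=> x; rewrite inE => /predU1P[->|/sS //].
  have E c : @FreeGroup _ [:: (t, c)] isT = if c then fgen t else (fgen t)^-1%g.
    by case: c; apply: fword_inj.
  by rewrite E; case: b {gE gn rg E}; [left | right; rewrite invgK]; exact: F2_basis_fgen.
by rewrite big_cons sE; apply: fword_inj; rewrite gE fwordM [LHS]lpush_cons.
Qed.

Lemma word_norm_ge_size g : (size (fword g))%:R <= word_norm F2_basis R g.
Proof.
apply: lb_le_inf.
  by have [s hs] := word_exists g; exists (size s)%:R, s.
move=> _ [s [sS <-] <-]; rewrite ler_nat; elim: s sS => [|x s IH] sS.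
  by rewrite big_nil.
rewrite big_cons; apply: leq_trans (size_fwordM _ _) _; rewrite -[leqRHS]add1n leq_add //.
  have : F2_basis x \/ F2_basis x^-1%g by apply: sS; rewrite mem_head.
  by case=> E; [|rewrite -size_finvw -fwordV]; case: E => ->.
by apply: IH => y ys; apply: sS; rewrite inE ys orbT.
Qed.

End WordNorm.

Section PeriodDoublingAction.
Variable R : realType.

Let Y : metricType R := realization R pd_graph.
Let act : F2 -> Y -> Y := fun g => rmap (pd_action g).
Let o : Y := rvertex R (1%g : pd_graph).

Let pd_element n : F2 := FreeGroup (reduced_pd_word 0 n).

(** Words of the language are moved at most one unit from the identity, however
    long they are. *)
Lemma rdist_pd_element n : mdist o (act (pd_element n) o) <= 1.
Proof.
rewrite /act rmap_vertex [mdist _ _]rdist_vertex lern1 /=.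
apply/(gdist_pieces pd_piece_language pd_adj_sym pd_adj_irrefl pd_adj_connected pd_adjP).
rewrite mulg1 invg1 mul1g; apply: pieces1 => //=; by exists 0%N, n; left.
Qed.

(** The action is transitive on the vertices, so every point of the graph is close
    to the orbit. *)
Lemma orbit_quasiconvex p : quasiconvex [set act g p | g in [set: F2]].
Proof.
have [_ _ actI] := isometric_action_rmap R pd_action.
exists (1 + mdist o p); first by rewrite addr_ge0 // mdist_ge0.
move=> _ _ S _ _ _ s _; have [y sy] := near_vertex s.
exists (act (y : F2) p); first by exists y.
apply: le_trans (metric_triangle s (rvertex R y : Y) _) _.
rewrite lerD // -(actI y o p) le_eqVlt; apply/orP; left; apply/eqP.
by congr (mdist _ _); rewrite rmap_vertex /= mulg1.
Qed.

Lemma orbit_map_not_qi p :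
  ~ qi_embedding (word_dist F2_basis R) (fun g : F2 => act g p).
Proof.
move=> [lam [eps [lam1 _ qi]]].
have [act1 _ actI] := isometric_action_rmap R pd_action.
have close n : mdist p (act (pd_element n) p) <= 2 * mdist p o + 1.
  have h1 := metric_triangle p o (act (pd_element n) p).
  have h2 := metric_triangle o (act (pd_element n) o) (act (pd_element n) p).
  have h3 := rdist_pd_element n; move: h2; rewrite /act actI -/act.
  by rewrite (metric_sym o p); lra.
pose n := (Num.truncn (lam * (2 * mdist p o + 1 + eps))).+1.
have big : lam * (2 * mdist p o + 1 + eps) < n%:R by exact: truncnS_gt.
have /andP[+ _] := qi 1%g (pd_element n).
rewrite [act 1%g p]act1 => lb; have := le_trans lb (close n).
rewrite lerBlDr leNgt => /negP; apply.
have lam0 : 0 < lam by exact: lt_le_trans lam1.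
rewrite ltr_pdivlMl //; apply: lt_le_trans big _.
rewrite /word_dist invg1 mul1g; apply: le_trans (word_norm_ge_size _ _).
by rewrite /= size_pd_word.
Qed.

Lemma pd_action_not_proper : ~ metrically_proper act.
Proof.
move=> /(_ o 2) /(sub_finite_set (A := range pd_element)) fin.
have : finite_set (range pd_element).
  apply: fin => _ [n _ <-]; exists (act (pd_element n) o); split.
    by rewrite /= ballEmdist /=; apply: le_lt_trans (rdist_pd_element n) _; rewrite ltr1n.
  by exists o => //; exact: ballxx.
move=> /(finite_image (fun g : F2 => size (fword g))) fin'.
case: infinite_nat; move: fin'.
apply: sub_finite_set => n _; exists (pd_element n); first by exists n.
by rewrite /= size_pd_word.
Qed.

(** Both geodesics follow the same tree geodesic, as the Cayley graph is itself the
    graph of pieces of the language of words of length at most one. *)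
Lemma geodesics_hausdorff_close (x y : F2) alpha (beta : set Y) :
  geodesic_segment (rvertex R (x : cayley_F2)) (rvertex R (y : cayley_F2)) alpha ->
  geodesic_segment (rvertex R (pd_inclusion x) : Y) (rvertex R (pd_inclusion y)) beta ->
  hausdorff_close 9 (rmap pd_inclusion @` alpha : set Y) beta.
Proof.
move=> galpha gbeta.
have self (A : graph) (u : A) : rdist (rvertex R u) (rvertex R u) <= 1.
  by rewrite rdist_xx ler01.
have incl (z : realization R cayley_F2) (m : F2) :
    rdist (rmap pd_inclusion z) (rvertex R (m : pd_graph))
      <= rdist z (rvertex R (m : cayley_F2)).
  by have := rdist_rmap_le pd_inclusion z (rvertex R (m : cayley_F2)); rewrite rmap_vertex.
split=> [_ [z az <-]|z bz].
  have [m xmy zm] := near_tree_geodesic (letter_piece_language bool) cayley_adjP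
    (geodesic_segment_dist galpha az) (self _ _) (self _ _).
  have [s bs ms] := near_geodesic pd_piece_language pd_adjP gbeta (self _ _) (self _ _) xmy.
  exists s => //; have := rdist_triangle (rvertex R (m : pd_graph)) (rmap pd_inclusion z) s.
  by have := incl z m; rewrite [mdist _ _]/(rdist _ _); lra.
have [m xmy zm] := near_tree_geodesic pd_piece_language pd_adjP
  (geodesic_segment_dist gbeta bz) (self _ _) (self _ _).
have [s as_ ms] := near_geodesic (letter_piece_language bool) cayley_adjP
  galpha (self _ _) (self _ _) xmy.
exists (rmap pd_inclusion s); first by exists s.
have := rdist_triangle (rvertex R (m : pd_graph)) z (rmap pd_inclusion s).
have := incl s m; rewrite (rdist_sym (rmap _ _)) (rdist_sym s).
by rewrite -[mdist _ _]/(rdist _ _); lra.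
Qed.

End PeriodDoublingAction.

Theorem theorem1 (R : realType) :
  exists (Y : graph) (rho : graph_action F2 Y)
         (iota : graph_embedding cayley_F2 Y),
    let Yr : metricType R := realization R Y in
    let act : F2 -> Yr -> Yr := fun g => rmap (rho g) in
    gromov_hyperbolic Yr
    /\ isometric_action act
    /\ (forall g x : F2, iota (g * x)%g = rho g (iota x))
    /\ acylindrical act
    /\ purely_loxodromic act
    /\ (forall (p : Yr) (g : F2), g != 1%g ->
          1 / 7 <= translation_length act p g)
    /\ (forall p : Yr, quasiconvex [set act g p | g in [set: F2]])
    /\ (exists2 C : R, 1 <= C &
          forall (x y : F2) (alpha : set (realization R cayley_F2))
                 (beta : set Yr),
            geodesic_segment (rvertex R (x : cayley_F2)) (rvertex R (y : cayley_F2)) alpha ->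
            geodesic_segment (rvertex R (iota x) : Yr) (rvertex R (iota y)) beta ->
            hausdorff_close C (rmap iota @` alpha : set Yr) beta)
    /\ (forall p : Yr,
          ~ qi_embedding (word_dist F2_basis R) (fun g : F2 => act g p))
    /\ ~ metrically_proper act.
Proof.
exists pd_graph, pd_action, pd_inclusion => Yr act.
have iso : isometric_action act by exact: isometric_action_rmap.
have lin g p : g != 1%g -> exists C : R,
    forall n, n%:R * 5%:R^-1 - C <= mdist p (act (g ^+ n)%g p).
  by move=> g1; apply: (rdist_power pd_piece_language pd_adjP pd_lang_period).
split.
  exact: (piece_graph_hyperbolic R pd_piece_language pd_adj_sym pd_adj_irrefl
    pd_adj_connected pd_adjP).
split; first exact: iso.
split; first by [].
split; first by apply: (piece_graph_acylindrical pd_piece_language pd_adjP pd_lang_period).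
split.
  move=> g g1; apply: (loxodromic_linear iso) => p; have [C hC] := lin g p g1.
  by exists 5%:R^-1, C; split=> //; rewrite invr_gt0.
split.
  move=> p g g1; have [C hC] := lin g p g1.
  by apply: (translation_length_ge iso (a := 5%:R^-1) (C := C)) => //; lra.
split; first exact: orbit_quasiconvex.
split; first by exists 9; [rewrite ler1n | exact: geodesics_hausdorff_close].
split; [exact: orbit_map_not_qi | exact: pd_action_not_proper].
Qed.
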